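(* Let $$\mathfrak x:=\sup\Big\{\inf\big\{\gamma\in\mathbb R^{+}:\gamma\text{ is a determinant bound of }H\text{ and }\mathbf 1_{\mathbb R}\big\}\Big\},$$ where the supremum is over all (possibly unbounded) self-adjoint operators $H=H^{*}$ acting on a separable Hilbert space $\mathfrak h$ with orthonormal basis $\{\varphi_{\mathfrak i}\}_{\mathfrak i\in\mathbb I}$, and $\mathbf 1_{\mathbb R}$ is the constant function $1$ on $\mathbb R$. Then $\mathfrak x=1$.
   Context: Scalar products are antilinear in the first and linear in the second argument. $\mathbb N=\{1,2,\dots\}$, $\mathbb R^{+}=(0,\infty)$, $\mathbb R_0^{+}=[0,\infty)$. For a real matrix, $\mathfrak M\ge0$ means that $\mathfrak M$ is symmetric and positive semidefinite. Functions of self-adjoint operators are defined by the spectral calculus. The infimum of an empty set is $+\infty$. Discrete torus: for $\beta>0$ and $n\in2\mathbb N$, $\mathbb T_n=\{-\beta+kn^{-1}\beta:k=1,\dots,2n\}$, viewed as a discrete torus of length $2\beta$ (arguments are added modulo $2\beta$, $-\beta\equiv\beta$). $\ell^2_{\mathrm{ap}}(\mathbb T_n;\mathfrak h)$ is the Hilbert space of functions $f:\mathbb T_n\to\mathfrak h$ with $f(\alpha+\beta)=-f(\alpha)$ for all $\alpha\in\mathbb T_n$, with scalar product $n^{-1}\beta\sum_{\alpha\in\mathbb T_n}\langle f_1(\alpha),f_2(\alpha)\rangle_{\mathfrak h}$. For $\varphi\in\mathfrak h$, $\hat\varphi\in\ell^2_{\mathrm{ap}}(\mathbb T_n;\mathfrak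 h)$ is $\hat\varphi(\alpha)=\delta_{\mathrm{ap}}(\alpha)\varphi$, where $\delta_{\mathrm{ap}}(0)=\beta^{-1}n/2$, $\delta_{\mathrm{ap}}(\beta)=-\beta^{-1}n/2$ and $\delta_{\mathrm{ap}}(\alpha)=0$ otherwise. For an operator $A$ on $\mathfrak h$ with domain $\mathrm{dom}(A)$, $\hat A$ is the operator with domain $\ell^2_{\mathrm{ap}}(\mathbb T_n;\mathrm{dom}(A))$ given by $(\hat Af)(\alpha)=A(f(\alpha))$. The discrete derivative is $(\partial f)(\alpha)=\beta^{-1}n\,(f(\alpha+n^{-1}\beta)-f(\alpha))$. For self-adjoint $H$, $\partial+\hat H$ is normal with bounded inverse, and the discrete-time covariance is $C_H=-2(\partial+\hat H)^{-1}\in\mathcal B(\ell^2_{\mathrm{ap}}(\mathbb T_n;\mathfrak h))$ (it depends on $\beta$ and $n$). Determinant bound: let $\mathfrak h$ be a separable Hilbert space with orthonormal basis $\{\varphi_{\mathfrak i}\}_{\mathfrak i\in\mathbb I}$, $\mathbb I$ countable, $H=H^*$ acting on $\mathfrak h$, and $\kappa:\mathbb R\to\mathbb R_0^+$ measurable. A number $\gamma\in\mathbb R^{+}$ is a determinant bound of $H$ and $\kappa$ if, for any $\beta\in\mathbb R^{+}$, $n\in2\mathbb N$, $m,N\in\mathbb N$, $\mathfrak M\in\mathrm{Mat}(m,\mathbb R)$ with $\mathfrak M\ge0$, and all parameters $\{(\alpha_q,\mathfrak i_q,j_q)\}_{q=1}^{2N}\subset(\mathbb T_n\cap[0,\beta))\times\mathbb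 I\times\{1,\dots,m\}$, $$\left|\det\Big[\mathfrak M_{j_k,j_{N+l}}\big\langle\varphi_{\mathfrak i_{N+l}},\big(C_H\kappa(\hat H)\hat\varphi_{\mathfrak i_k}\big)(\alpha_k-\alpha_{N+l})\big\rangle_{\mathfrak h}\Big]_{k,l=1}^{N}\right|\le\gamma^{2N}\prod_{q=1}^{2N}\mathfrak M_{j_q,j_q}^{1/2}.$$ *)

(* Defs.v *)
From HB Require Import structures.
From mathcomp Require Import all_boot all_order all_algebra.
From mathcomp Require Import all_classical all_reals all_analysis.
From mathcomp Require Import ring lra zify.
From mathcomp Require Export complex.

Set Implicit Arguments.
Unset Strict Implicit.
Unset Printing Implicit Defensive.

Import Order.TTheory GRing.Theory Num.Theory.
Import numFieldNormedType.Exports.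

Local Open Scope classical_set_scope.
Local Open Scope ring_scope.
Local Open Scope complex_scope.

(** Hilbert spaces over the complex numbers [R[i]].  The forms [{dot V for _}]
    of the library are linear in the first argument, whence the exchange of
    arguments in [braket], which is linear in the second one. *)
Section Hilbert.
Variables (R : realType) (V : completeNormedModType R[i]).
Implicit Types dot : {dot V for Num.conj}.

Definition braket dot (x y : V) : R[i] := dot y x.

(** As [V] is complete, it is a Hilbert space as soon as its norm is the one
    given by the scalar product. *)
Definition hilbert_norm dot : Prop :=
  forall x : V, braket dot x x = `|x| ^+ 2.

Definition orthonormal_basis dot (I : countType) (phi : I -> V) : Prop :=
  (forall i j, braket dot (phi i) (phi j) = (i == j)%:R) /\
  closure [set x : V | exists (s : seq I) (c : I -> R[i]),
                         x = \sum_(i <- s) c i *: phi i] = setT.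

End Hilbert.

(** Unbounded operators are given by their graphs. *)
Section Operators.
Variables (R : realType) (E : lmodType R[i]).
Implicit Types A B : set (E * E).

Definition linear_operator A : Prop :=
  [/\ A (0, 0),
      forall (a : R[i]) x y x' y',
        A (x, y) -> A (x', y') -> A (a *: x + x', a *: y + y')
    & forall y, A (0, y) -> y = 0].

Definition op_dom A : set E := [set x | exists y, A (x, y)].

(** [op_app A x] is [A x] when [x] is in the domain of the operator [A]. *)
Definition op_app A (x : E) : E := xget 0 [set y | A (x, y)].

Definition op_add A B : set (E * E) :=
  [set p | exists y z, [/\ A (p.1, y), B (p.1, z) & p.2 = y + z]].

Definition op_scale (a : R[i]) A : set (E * E) :=
  [set p | exists2 y, A (p.1, y) & p.2 = a *: y].

Definition op_inv A : set (E * E) := [set p | A (p.2, p.1)].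

(** [op_comp A B] is the product [A B]: [B] is applied first. *)
Definition op_comp A B : set (E * E) :=
  [set p | exists2 y, B (p.1, y) & A (y, p.2)].

Definition op_adjoint (ip : E -> E -> R[i]) A : set (E * E) :=
  [set p | forall x y, A (x, y) -> ip p.1 y = ip p.2 x].

(** [P] is a projection-valued measure on the Borel sets of the real line, and
    [mu x] is the scalar measure [B |-> <x, P B x>]. *)
Definition spectral_measure (ip : E -> E -> R[i]) (P : set R -> E -> E)
    (mu : E -> {measure set (measurableTypeR R) -> \bar R}) : Prop :=
  [/\ forall B : set (measurableTypeR R), measurable B ->
        [/\ linear (P B),
            forall x, P B (P B x) = P B x
          & forall x y, ip x (P B y) = ip (P B x) y],
      forall x, P setT x = x
    & forall x (B : set (measurableTypeR R)), measurable B ->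
        mu x B = (complex.Re (ip x (P B x)))%:E].

(** [A] is the integral of the real function [f] with respect to the
    projection-valued measure with scalar measures [mu]: the domain of [A] is
    the set of [x] such that [f] is in [L^2(mu x)] and, by polarization, the
    quadratic form of [A] determines [A]. *)
Definition spectral_integral (ip : E -> E -> R[i])
    (mu : E -> {measure set (measurableTypeR R) -> \bar R})
    (f : R -> R) A : Prop :=
  [/\ linear_operator A,
      op_dom A =
        [set x | (\int[mu x]_(t in setT) ((f t) ^+ 2)%:E < +oo)%E]
    & forall x y, A (x, y) ->
        ip x y = (\int[mu x]_(t in setT) f t)%:C].

(** [K] is [f(A)] in the spectral calculus of the self-adjoint operator [A]. *)
Definition spectral_calculus (ip : E -> E -> R[i]) A (f : R -> R)
    (K : set (E * E)) : Prop :=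
  exists P mu, [/\ spectral_measure ip P mu,
                   spectral_integral ip mu id A
                 & spectral_integral ip mu f K].

End Operators.

Definition self_adjoint (R : realType) (V : completeNormedModType R[i])
    (dot : {dot V for Num.conj}) (H : set (V * V)) : Prop :=
  [/\ linear_operator H, closure (op_dom H) = setT
    & H = op_adjoint (braket dot) H].

(** For [0 < n] the class of [k] in ['Z_(n.*2)] stands for the point
    [k * beta / n] of the discrete torus, taken modulo [2 * beta]; thus [0], [1]
    and [n%:R] stand for [0], [beta / n] and [beta].  [torus_pt] is the
    representative in [(-beta, beta]]. *)
Definition torus_pt (R : realType) (beta : R) (n : nat) (a : 'Z_(n.*2)) : R :=
  if (a <= n)%N then a%:R * (beta / n%:R) else (a%:R - n.*2%:R) * (beta / n%:R).

Section TorusPoints.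
Variables (R : realType) (beta : R) (n : nat).
Hypothesis (n0 : (0 < n)%N).

Let ltn_pt (a : 'Z_(n.*2)) : (a < n.*2)%N.
Proof. by case: n n0 a => // k _ a; exact: ltn_ord. Qed.

Let n2R : n.*2%:R = n%:R + n%:R :> R.
Proof. by rewrite -addnn natrD. Qed.

Lemma range_torus_pt :
  range (torus_pt beta (n := n)) =
  [set x | exists2 k, (1 <= k <= n.*2)%N & x = - beta + k%:R * (beta / n%:R)].
Proof.
have nR : n%:R != 0 :> R by rewrite pnatr_eq0 -lt0n.
apply/seteqP; split=> [_ [a _ <-]|_ [k /andP[k1 kn] ->]].
  have an := ltn_pt a; rewrite /torus_pt; case: leqP => na.
    exists (a + n)%N; first by lia.
    by rewrite natrD; field.
  exists (a - n)%N; first by lia.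
  by rewrite natrB 1?ltnW // n2R; field.
have n2 : (1 < n.*2)%N by lia.
have [nk|kn'] := leqP n k.
  exists (k - n)%:R => //; rewrite /torus_pt val_Zp_nat // modn_small; last by lia.
  by rewrite ifT; [rewrite natrB //; field | lia].
exists (k + n)%:R => //; rewrite /torus_pt val_Zp_nat // modn_small; last by lia.
by rewrite ifF; [rewrite natrD n2R; field | lia].
Qed.

Lemma torus_ptD (a b : 'Z_(n.*2)) : exists z : int,
  torus_pt beta (a + b) = torus_pt beta a + torus_pt beta b + z%:~R * (2 * beta).
Proof.
have nR : n%:R != 0 :> R by rewrite pnatr_eq0 -lt0n.
have pt (c : 'Z_(n.*2)) : exists z : int,
    torus_pt beta c = c%:R * (beta / n%:R) + z%:~R * (2 * beta).
  rewrite /torus_pt; case: ifP => _; first by exists 0; rewrite mul0r addr0.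
  by exists (-1); rewrite n2R; field.
have [x ->] := pt a; have [y ->] := pt b; have [z ->] := pt (a + b).
have n2 : (1 < n.*2)%N by lia.
have -> : (nat_of_ord (a + b)%R)%:R = a%:R + b%:R - ((a + b) %/ n.*2)%N%:R * n.*2%:R :> R.
  have := congr1 (fun k : nat => k%:R : R) (divn_eq (a + b) n.*2).
  rewrite -natrD => ->; rewrite natrD natrM [RHS]addrC addKr.
  by congr (_%:R); congr (_ %% _)%N; apply: Zp_cast.
exists (z - x - y - ((a + b) %/ n.*2)%N%:Z).
by rewrite !rmorphB /= -[((a + b) %/ n.*2)%N%:Z%:~R]/(((a + b) %/ n.*2)%N%:R) n2R; field.
Qed.

End TorusPoints.

(** The space of antiperiodic functions on the discrete torus. *)
Section Antiperiodic.
Variables (R : realType) (V : lmodType R[i]) (n : nat).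

Definition antiperiodic : {pred {ffun 'Z_(n.*2) -> V}} :=
  fun f => [forall a, f (a + n%:R) == - f a].

Fact antiperiodic_submod : submod_closed antiperiodic.
Proof.
split=> [|c f g /forallP apf /forallP apg]; apply/forallP => a.
  by rewrite !ffunE oppr0.
by rewrite !ffunE (eqP (apf a)) (eqP (apg a)) scalerN opprD.
Qed.
HB.instance Definition _ :=
  GRing.isSubmodClosed.Build R[i] _ antiperiodic antiperiodic_submod.

Record l2ap := L2ap {
  l2ap_val :> {ffun 'Z_(n.*2) -> V};
  l2ap_valP : l2ap_val \in antiperiodic }.

HB.instance Definition _ := [isSub for l2ap_val].
HB.instance Definition _ := [Choice of l2ap by <:].
HB.instance Definition _ := [SubChoice_isSubLmodule of l2ap by <:].

End Antiperiodic.

Section Covariance.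
Variables (R : realType) (V : lmodType R[i]) (beta : R) (n : nat).
Local Notation E := (l2ap V n).

Definition l2ap_ip (ip : V -> V -> R[i]) (f g : E) : R[i] :=
  (beta / n%:R)%:C * \sum_(a : 'Z_(n.*2)) ip (f a) (g a).

Definition delta_ap (a : 'Z_(n.*2)) : R :=
  if a == 0 then n%:R / (2 * beta)
  else if a == n%:R then - (n%:R / (2 * beta)) else 0.

Definition hat_vec (x : V) : E :=
  insubd 0 [ffun a => (delta_ap a)%:C *: x].

Lemma hat_vecE x a : (0 < n)%N -> hat_vec x a = (delta_ap a)%:C *: x.
Proof.
move=> n0; rewrite /hat_vec.
set f := [ffun a => _].
have valn : (n%:R : 'Z_(n.*2)) = n :> nat.
  rewrite val_Zp_nat; last by rewrite -(ltn_double 0) in n0; case: (n) n0 => [|[]].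
  by rewrite modn_small // -addnn -{1}(addn0 n) ltn_add2l.
have n_neq0 : (n%:R : 'Z_(n.*2)) != 0.
  by rewrite -val_eqE /= valn -lt0n.
have nn0 : (n%:R : 'Z_(n.*2)) + n%:R = 0.
  by rewrite -natrD addnn pchar_Zp // -addnn; case: (n) n0 => [|[|k]].
have apf : f \in @antiperiodic R V n.
  apply/forallP => b; rewrite !ffunE -scaleNr -rmorphN /=; apply/eqP.
  congr (_%:C *: _); rewrite /delta_ap.
  have [->|b0] := eqVneq b 0; first by rewrite add0r (negbTE n_neq0) eqxx.
  have [->|bn] := eqVneq b n%:R; first by rewrite nn0 eqxx opprK.
  have nN : - n%:R = n%:R :> 'Z_(n.*2) by apply/eqP; rewrite eq_sym -addr_eq0 nn0.
  rewrite addr_eq0 nN (negbTE bn) -subr_eq0 addrK (negbTE b0).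
  by rewrite oppr0.
by rewrite (_ : insubd 0 f = L2ap apf) ?ffunE // /insubd insubT.
Qed.

Definition hat_op (A : set (V * V)) : set (E * E) :=
  [set p : E * E | forall a, A (p.1 a, p.2 a)].

Definition partial : set (E * E) :=
  [set p : E * E | forall a, p.2 a = (n%:R / beta)%:C *: (p.1 (a + 1) - p.1 a)].

Definition covariance (H : set (V * V)) : set (E * E) :=
  op_scale (- 2) (op_inv (op_add partial (hat_op H))).

End Covariance.

Definition psd (R : realType) (m : nat) (M : 'M[R]_m) : Prop :=
  M^T = M /\ forall v : 'cV[R]_m, 0 <= (v^T *m M *m v) 0 0.

(** The index [q] ranges over ['I_(N + N)]: [lshift N k] and [rshift N l] are
    the indices written [k] and [N + l].  [K] is the operator [kappa(H^)]: by
    the spectral theorem there is exactly one such [K]. *)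
Definition determinant_bound (R : realType) (V : completeNormedModType R[i])
    (dot : {dot V for Num.conj}) (I : countType) (phi : I -> V)
    (H : set (V * V)) (kappa : R -> R) (gamma : R) : Prop :=
  [/\ measurable_fun setT kappa, forall t, 0 <= kappa t, 0 < gamma &
  forall (beta : R) (n : nat) (K : set (l2ap V n * l2ap V n)),
    0 < beta -> (0 < n)%N -> ~~ odd n ->
    spectral_calculus (l2ap_ip beta (braket dot)) (hat_op H) kappa K ->
  forall (m N : nat) (M : 'M[R]_m), (0 < m)%N -> (0 < N)%N -> psd M ->
  forall (alpha : 'I_(N + N) -> 'Z_(n.*2)) (i : 'I_(N + N) -> I)
         (j : 'I_(N + N) -> 'I_m),
    (forall q, 0 <= torus_pt beta (alpha q) < beta) ->
    `| \det (\matrix_(k < N, l < N)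
         ((M (j (lshift N k)) (j (rshift N l)))%:C *
          braket dot (phi (i (rshift N l)))
            (op_app (op_comp (covariance beta H) K)
               (hat_vec beta n (phi (i (lshift N k))))
               (alpha (lshift N k) - alpha (rshift N l))))) |
    <= (gamma ^+ (2 * N) *
        \prod_(q < N + N) Num.sqrt (M (j q) (j q)))%:C].

(* Main.v *)
Require Import Defs.
From HB Require Import structures.
From mathcomp Require Import all_boot all_order all_algebra.
From mathcomp Require Import perm sesquilinear spectral.
From mathcomp Require Import all_classical all_reals all_analysis.
From mathcomp Require Import measurable_realfun.
From mathcomp Require Import ring lra zify.

Set Implicit Arguments.
Unset Strict Implicit.
Unset Printing Implicit Defensive.

Import Order.TTheory GRing.Theory Num.Theory.
Import numFieldNormedType.Exports.

Local Open Scope ring_scope.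
Local Open Scope sesquilinear_scope.

(** The function [f = C_H phi] satisfies [f(a+1) = r f(a)] away from the origin,
    with [r = 1 - (beta/n) H], so the entries of the matrix are the scalar
    products of basis vectors with [r^c (1 + r^n)^-1 phi].  Only finitely many
    such vectors matter: a Hermitian extension of the compression of [r] to
    their span replaces [r] by a real diagonal matrix, and a factorization
    [M = B B^*] is absorbed by a tensor product.  By Wick's theorem the
    determinant is then, up to a sign, the quotient by [tr (G^n)] of a trace
    [tr (G X_1 ... G X_n)] on a finite-dimensional Fock space, where [G] is the
    second quantization of [r] and the [X_t] are products of creation and
    annihilation operators of vectors of norm at most one, hence contractions.
    As [n] is even, a chessboard estimate bounds the trace by [tr (G^n)], so
    that 1 is a determinant bound.

    For the converse take [H = -1] on the complex line and [N = 1]: with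
    [r = 1 + beta/n] the single entry [r^(n-1) / (1 + r^n)] is arbitrarily close
    to 1 if [beta/n] is small and [beta] large. *)

(** * Creation and annihilation operators and second quantization on a fermionic Fock space *)

Section Fock.
Variable C : numClosedFieldType.
Implicit Types (d : nat) (f v u r : nat -> C).

Fixpoint fock_dim d : nat := if d is d'.+1 then fock_dim d' + fock_dim d' else 1.

(** Jordan-Wigner form of [\sum_i f i a_i]: the two blocks are the states with the last mode empty
    or occupied, and the sign in the second one makes different modes anticommute. *)
Fixpoint annih d f : 'M[C]_(fock_dim d) :=
  if d is d'.+1 return 'M[C]_(fock_dim d)
  then block_mx (annih d' f) (f d')%:M 0 (- annih d' f) else 0.

(** The inner conjugation makes [creat] linear in [u], as [annih] is in [f], so that their
    anticommutator is bilinear. *)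
Definition creat d u : 'M[C]_(fock_dim d) := (annih d (fun i => (u i)^*))^t*.

(* The second quantization of the diagonal matrix with entries [r]. *)
Fixpoint gam d r : 'M[C]_(fock_dim d) :=
  if d is d'.+1 return 'M[C]_(fock_dim d)
  then block_mx (gam d' r) 0 0 (r d' *: gam d' r) else 1%:M.

Lemma adjmxM m n p (A : 'M[C]_(m, n)) (B : 'M[C]_(n, p)) :
  (A *m B)^t* = B^t* *m A^t*.
Proof. by rewrite trmx_mul map_mxM. Qed.

Lemma adjmxD m n (A B : 'M[C]_(m, n)) : (A + B)^t* = A^t* + B^t*.
Proof. by rewrite linearD /= map_mxD. Qed.

Lemma annih_ext d f g : (forall i, (i < d)%N -> f i = g i) -> annih d f = annih d g.
Proof.
elim: d => //= d IH fg; rewrite IH ?fg // => i id; exact/fg/ltnW.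
Qed.

Lemma annihD d f g : annih d (fun i => f i + g i) = annih d f + annih d g.
Proof.
elim: d => /= [|d IH]; first by rewrite addr0.
by rewrite IH add_block_mx raddfD /= addr0 opprD.
Qed.

Lemma annih_gam d f r :
  annih d f *m gam d r = gam d r *m annih d (fun i => r i * f i).
Proof.
elim: d => /= [|d IH]; first by rewrite mul0mx mulmx0.
rewrite !mulmx_block !mul0mx !mulmx0 !addr0 !add0r IH.
congr block_mx; last by rewrite mulNmx mulmxN -scalemxAl -scalemxAr IH.
by rewrite mul_scalar_mx mul_mx_scalar scalerA mulrC.
Qed.

Lemma annih_gamX d f r k :
  annih d f *m (gam d r ^+ k) =
  gam d r ^+ k *m annih d (fun i => r i ^+ k * f i).
Proof.
elim: k f => [|k IH] f.
  by rewrite expr0 mul1mx mulmx1; apply: annih_ext => i _; rewrite expr0 mul1r.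
rewrite exprS -mulmxE mulmxA annih_gam -mulmxA IH mulmxA.
by congr (_ *m _); apply: annih_ext => i _; rewrite exprSr mulrA.
Qed.

Lemma annih_anticomm d f g : annih d f *m annih d g = - (annih d g *m annih d f).
Proof.
elim: d => /= [|d IH]; first by rewrite mulmx0 oppr0.
rewrite !mulmx_block !mul0mx !mulmx0 !addr0 !add0r opp_block_mx oppr0.
rewrite !(mulmxN, mulNmx) !opprK -IH !mul_scalar_mx !mul_mx_scalar.
by congr block_mx; rewrite ?opprD ?opprK ?IH ?opprK // addrC.
Qed.

Lemma annih_creat d f u :
  annih d f *m creat d u + creat d u *m annih d f = (\sum_(i < d) f i * u i)%:M.
Proof.
rewrite /creat; elim: d => /= [|d IH].
  by rewrite big_ord0 mul0mx trmx0 map_mx0 mulmx0 addr0 raddf0.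
set a := annih d f in IH *; set b := annih d _ in IH *.
rewrite tr_block_mx map_block_mx !trmx0 !map_mx0 tr_scalar_mx map_scalar_mx /=
  conjCK.
rewrite !linearN /= map_mxN.
rewrite !mulmx_block !mul0mx !mulmx0 !addr0 !add0r add_block_mx.
rewrite big_ord_recr /= raddfD /=; set S := (\sum_(i < d) _)%:M in IH *.
have -> : f d * u d = u d * f d by rewrite mulrC.
rewrite !(mulmxN, mulNmx) !opprK !mul_scalar_mx !mul_mx_scalar.
rewrite !scalar_mx_block add_block_mx !addr0 -/S -IH !addNr !scale_scalar_mx.
by rewrite [f d * _]mulrC addrAC (addrC (u d * f d)%:M) addrA.
Qed.

Lemma adj_annih d f : (annih d f)^t* = creat d (fun i => (f i)^*).
Proof. by rewrite /creat (@annih_ext d (fun i => (f i)^* ^*) f) // => i _;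
  rewrite conjCK. Qed.

Lemma adj_gam d r : (forall i, r i \is Num.real) -> (gam d r)^t* = gam d r.
Proof.
move=> rR; elim: d => /= [|d IH]; first by rewrite trmx1 map_mx1.
rewrite tr_block_mx map_block_mx !trmx0 !map_mx0 linearZ /= map_mxZ IH.
by congr block_mx; congr (_ *: _); exact/CrealP/rR.
Qed.

Lemma gamX d r k : gam d r ^+ k = gam d (fun i => r i ^+ k).
Proof.
elim: k => [|k IH].
  rewrite expr0; elim: d => //= d IH.
  by rewrite expr0 scale1r -IH -scalar_mx_block.
rewrite exprS IH -mulmxE; elim: d {IH} => /= [|d IH]; first by rewrite mulmx1.
rewrite mulmx_block !mul0mx !mulmx0 !addr0 !add0r IH -scalemxAl -scalemxAr IH.
by rewrite scalerA exprS.
Qed.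

Lemma mxtrace_gam d r : \tr (gam d r) = \prod_(i < d) (1 + r i).
Proof.
elim: d => /= [|d IH]; first by rewrite mxtrace1 big_ord0.
by rewrite mxtrace_block linearZ /= IH big_ord_recr /= mulrDr mulr1 [r d * _]mulrC.
Qed.

End Fock.

(** * Hilbert-Schmidt norms, contractions and the chessboard estimate *)

Section Contractions.
Variable C : numClosedFieldType.

Definition hs m n (A : 'M[C]_(m, n)) : C := \tr (A *m A^t*).

Lemma hsE m n (A : 'M[C]_(m, n)) : hs A = \sum_i \sum_j `|A i j| ^+ 2.
Proof.
apply: eq_bigr => i _; rewrite mxE; apply: eq_bigr => j _.
by rewrite !mxE normCK.
Qed.

Lemma hs_ge0 m n (A : 'M[C]_(m, n)) : 0 <= hs A.
Proof. by rewrite hsE; do 2!apply: sumr_ge0 => ? _; rewrite exprn_ge0. Qed.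

Lemma hs_adj m n (A : 'M[C]_(m, n)) : hs (A^t*) = hs A.
Proof. by rewrite /hs trmxCK mxtrace_mulC. Qed.

Lemma hs_cauchy m n (A : 'M[C]_(m, n)) (B : 'M[C]_(n, m)) :
  `|\tr (A *m B)| ^+ 2 <= hs A * hs B.
Proof.
have trE (D E : 'M[C]_(m, n)) : dotmx (mxvec D) (mxvec E) = \tr (D *m E^t*).
  rewrite dotmxE mxE (reindex _ (curry_mxvec_bij _ _)) /=.
  transitivity (\sum_i \sum_j D i j * (E i j)^*).
    by rewrite pair_bigA; apply: eq_bigr => -[i j] _; rewrite !mxE !mxvecE.
  by apply: eq_bigr => i _; rewrite mxE; apply: eq_bigr => j _; rewrite !mxE.
rewrite -(hs_adj B) -{1}[B]trmxCK /hs -!trE.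
by case: (CauchySchwarz (@dotmx C (m * n)) (mxvec A) (mxvec (B^t*))).
Qed.

(** Operator norm at most one, expressed by Hilbert-Schmidt norms; asking it of [X] and of its
    adjoint makes stability under adjoints and products immediate. *)
Definition contraction p (X : 'M[C]_p) :=
  forall m (A : 'M[C]_(m, p)), hs (A *m X) <= hs A /\ hs (A *m X^t*) <= hs A.

Lemma contraction1 p : contraction (1%:M : 'M[C]_p).
Proof. by move=> m A; rewrite trmx1 map_mx1 mulmx1. Qed.

Lemma contraction_adj p (X : 'M[C]_p) : contraction X -> contraction (X^t*).
Proof. by move=> cX m A; rewrite trmxCK; case: (cX m A). Qed.

Lemma contractionM p (X Y : 'M[C]_p) :
  contraction X -> contraction Y -> contraction (X *m Y).
Proof.
move=> cX cY m A; rewrite adjmxM !mulmxA; split.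
  exact: le_trans (cY _ _).1 (cX _ _).1.
exact: le_trans (cX _ _).2 (cY _ _).2.
Qed.

Lemma contraction_annih d (f : nat -> C) :
  \sum_(i < d) `|f i| ^+ 2 <= 1 -> contraction (annih d f).
Proof.
move=> f1 m A.
(* By the anticommutation relation [a a^* + a^* a] is the scalar [\sum_i |f i|^2], so both norms
   together are at most that of [A]. *)
have sum1 : hs (A *m annih d f) + hs (A *m (annih d f)^t*) <= hs A.
  rewrite /hs !adjmxM trmxCK !mulmxA -raddfD /= -mulmxDl -!(mulmxA A) -mulmxDr.
  rewrite adj_annih annih_creat mul_mx_scalar -scalemxAl mxtraceZ.
  rewrite -[leRHS]mul1r ler_wpM2r ?hs_ge0 //; apply: le_trans f1.
  by under eq_bigr do rewrite -normCK.
split; apply: le_trans sum1; first by rewrite lerDl hs_ge0.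
by rewrite lerDr hs_ge0.
Qed.

Lemma contraction_creat d (u : nat -> C) :
  \sum_(i < d) `|u i| ^+ 2 <= 1 -> contraction (creat d u).
Proof.
move=> u1; apply/contraction_adj/contraction_annih.
by under eq_bigr do rewrite norm_conjC.
Qed.

(** Cauchy-Schwarz for [X A] and [Y B]; adjoints turn the left factors into right ones, which the
    contraction hypothesis removes. *)
Lemma trace_reflection p (X A Y B : 'M[C]_p) : contraction X -> contraction Y ->
  `|\tr (X *m A *m Y *m B)| ^+ 2 <= hs A * hs B.
Proof.
move=> cX cY; rewrite -mulmxA; apply: le_trans (hs_cauchy _ _) _.
by rewrite ler_pM ?hs_ge0 // -hs_adj adjmxM -(hs_adj A, hs_adj B);
  [case: (cX _ (A^t*)) | case: (cY _ (B^t*))].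
Qed.

End Contractions.

(* A contraction at a site [t] is replaced by [1] by reflecting the word in the
   site [t] and the opposite one, which by Cauchy-Schwarz does not decrease the
   largest value of the trace.  A maximizer with as many letters [1] as possible
   is therefore constant. *)
Section Chessboard.
Variables (C : numClosedFieldType) (p : nat) (G : 'M[C]_p) (J : finType).
Variables (phi : J -> 'M[C]_p) (one : J) (inv : J -> J).
Hypothesis adjG : G^t* = G.
Hypothesis phi1 : phi one = 1%:M.
Hypothesis phiV : forall j, phi (inv j) = (phi j)^t*.
Hypothesis inv_eq1 : forall j, (inv j == one) = (j == one).
Hypothesis phi_contr : forall j, contraction (phi j).

Let pw (s : seq J) : 'M[C]_p := \prod_(j <- s) (G *m phi j).
(** With [G] at both ends the adjoint of a word is again such a word, reversed and with [inv]
    applied to its letters. *)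
Let pq (s : seq J) : 'M[C]_p := pw s *m G.

Let pw_cat s t : pw (s ++ t) = pw s *m pw t.
Proof. by rewrite /pw big_cat. Qed.

Let pw_cons x s : pw (x :: s) = G *m phi x *m pw s.
Proof. by rewrite /pw big_cons. Qed.

Let pq_adj s : (pq s)^t* = pq (rev (map inv s)).
Proof.
elim: s => [|x s IH] /=; first by rewrite /pq /pw big_nil mul1mx.
rewrite /pq pw_cons -mulmxA adjmxM -/(pq s) IH adjmxM adjG -phiV.
by rewrite rev_cons -cats1 /pq pw_cat pw_cons /pw big_nil mulmx1 !mulmxA.
Qed.

Let tr_rot k s : \tr (pw (rot k s)) = \tr (pw s).
Proof. by rewrite /rot pw_cat mxtrace_mulC -pw_cat cat_take_drop. Qed.

(** The two letters [one] mark the axes of the reflection: [hs (pq s)] is the trace of this word. *)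
Let refl s := one :: s ++ one :: rev (map inv s).

Let hs_refl s : hs (pq s) = \tr (pw (refl s)).
Proof.
rewrite /hs pq_adj /refl pw_cons phi1 mulmx1 pw_cat pw_cons phi1 mulmx1.
by rewrite mxtrace_mulC -!mulmxA mxtrace_mulC /pq !mulmxA.
Qed.

Let count_refl s : count_mem one (refl s) = (count_mem one s).*2.+2.
Proof.
rewrite /= count_cat /= !eqxx count_rev count_map.
rewrite (@eq_count _ (preim inv (pred1 one)) (pred1 one));
  first by rewrite !add1n addnS addnn.
by move=> j /=; rewrite inv_eq1.
Qed.

Let pw_nseq k : pw (nseq k one) = G ^+ k.
Proof.
elim: k => [|k IH]; first by rewrite /pw big_nil.
by rewrite /= pw_cons IH phi1 mulmx1 exprS.
Qed.

Lemma chessboard m (s : seq J) : (0 < m)%N -> size s = m.*2 ->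
  `|\tr (pw s)| <= `|\tr (G ^+ m.*2)|.
Proof.
move=> m0 szs; pose F (t : m.*2.-tuple J) := `|\tr (pw t)|.
have /eqP szs' := szs; pose ts := Tuple szs'.
have [tm _ tmP] := @real_arg_maxP _ _ ts predT F isT (fun t _ => normr_real _).
have {}tmP t : F t <= F tm by apply: tmP.
apply: le_trans (tmP ts) _.
case: (@arg_maxnP _ tm (fun t => F t == F tm) (fun t => count_mem one t)) => //.
move=> t1 /eqP t1P t1max; rewrite -t1P.
have [/all_pred1P t1E|] := boolP (all (pred1 one) t1).
  by rewrite /F t1E size_tuple pw_nseq.
(* Rotation brings a letter [x] other than [one] to the front; the opposite letter [y] cuts the rest
   into [A] and [B], both of length [m - 1]. *)
move=> /allPn[x xt1 /= x1]; pose k := index x t1.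
have kt1 : (k < size t1)%N by rewrite index_mem.
have rotE : rot k t1 = x :: behead (rot k t1).
  by rewrite /rot (drop_nth x) //= nth_index.
set w := behead _ in rotE; pose A := take m.-1 w.
have szw : size w = m.-1 + m.-1.+1.
  by have := congr1 size rotE; rewrite size_rot size_tuple /=; lia.
have sA : size A = m.-1 by rewrite size_takel // szw leq_addr.
case wE : (drop m.-1 w) => [|y B].
  by have := size_drop m.-1 w; rewrite wE szw addKn.
have sB : size B = m.-1.
  by have := size_drop m.-1 w; rewrite wE szw addKn => -[].
have {}wE : w = A ++ y :: B by rewrite -wE cat_take_drop.
have szr D : size D = m.-1 -> size (refl D) == m.*2.
  by move=> sD; rewrite /= size_cat /= size_rev size_map sD; lia.
pose tA := Tuple (szr A sA); pose tB := Tuple (szr B sB).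
have [F0|F0] := eqVneq (F tm) 0; first by rewrite t1P F0.
have Fpos : 0 < F tm by rewrite lt_def F0 normr_ge0.
have F_refl (t : m.*2.-tuple J) D : tval t = refl D -> F t = hs (pq D).
  by move=> tE; rewrite /F tE -hs_refl ger0_norm ?hs_ge0.
have le2 : F t1 ^+ 2 <= F tA * F tB.
  rewrite (F_refl tA A) // (F_refl tB B) //.
  have -> : F t1 = `|\tr (phi x *m pq A *m phi y *m pq B)|.
    rewrite /F -(tr_rot k) rotE wE pw_cons pw_cat pw_cons.
    by rewrite -!mulmxA mxtrace_mulC /pq !mulmxA.
  exact: trace_reflection.
rewrite t1P expr2 in le2.
(* No word exceeds [F tm], while the product of the values at the two reflected words is at least
   its square: both are maximizers. *)
have FA : F tA == F tm.
  rewrite eq_le tmP -(ler_pM2r Fpos) (le_trans le2) //.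
  by rewrite ler_wpM2l ?tmP ?normr_ge0.
have FB : F tB == F tm.
  rewrite eq_le tmP -(ler_pM2l Fpos) (le_trans le2) //.
  by rewrite ler_wpM2r ?tmP ?normr_ge0.
have cA : (count_mem one (refl A) <= count_mem one t1)%N := t1max _ FA.
have cB : (count_mem one (refl B) <= count_mem one t1)%N := t1max _ FB.
(* The reflections contain [2a + 2] and [2b + 2] letters [one], with [a] and [b] those of [A] and
   [B]; [t1] has at most [a + b + 1], so one of them beats it. *)
have ct : count_mem one t1 = ((y == one) + count_mem one A + count_mem one B)%N.
  transitivity (count_mem one (rot k t1)).
    by apply/seq.permP; rewrite perm_sym perm_rot.
  by rewrite rotE wE /= (negbTE x1) add0n count_cat /= addnCA addnA.
move: cA cB; rewrite !count_refl ct.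
by move: (count_mem one A) (count_mem one B) (leq_b1 (y == one)) => a b; lia.
Qed.

End Chessboard.

Lemma trace_prod_le (C : numClosedFieldType) p (G : 'M[C]_p) m (s : seq 'M[C]_p) :
    G^t* = G -> {in s, forall X, contraction X} -> (0 < m)%N -> size s = m.*2 ->
  `|\tr (\prod_(X <- s) (G *m X))| <= `|\tr (G ^+ m.*2)|.
Proof.
move=> adjG cs m0 szs.
(* A finite alphabet of formal letters, closed under adjoints: [None] for the identity, a boolean
   for the adjoint. The positions [i] serve as letters, so that an entry of [s] equal to 1 is still
   distinct from [None]. *)
pose phi (j : option (bool * 'I_(size s))) : 'M[C]_p :=
  if j is Some (b, i) then (if b then (s`_i)^t* else s`_i) else 1%:M.
pose inv (j : option (bool * 'I_(size s))) :=
  if j is Some (b, i) then Some (~~ b, i) else None.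
have phiV j : phi (inv j) = (phi j)^t*.
  case: j => [[[] i]|] /=; rewrite ?trmxCK //.
  by rewrite trmx1 map_mx1.
have phi_contr j : contraction (phi j).
  case: j => [[[] i]|] /=; first exact/contraction_adj/cs/mem_nth.
    exact/cs/mem_nth.
  exact: contraction1.
have inv_eq1 j : (inv j == None) = (j == None) by case: j => [[]|].
have := @chessboard C p G _ phi None inv adjG erefl phiV inv_eq1 phi_contr m.
move/(_ [seq Some (false, i) | i <- enum 'I_(size s)] m0).
rewrite size_map size_enum_ord => /(_ szs); rewrite big_map.
rewrite -(big_map val predT (fun i => G *m s`_i)) val_enum_ord.
move=> le1; rewrite (big_nth 0) /index_iota subn0; apply: le_trans le1 => /=;
  rewrite le_eqVlt; apply/orP; left; apply/eqP; congr (`|\tr _|);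
    apply: eq_bigr => i _; congr (_ *m _).
Qed.

(** * Deletion of an entry from a sequence *)

Section Deletion.
Variable T : Type.
Implicit Types s t : seq T.

Fixpoint del (j : nat) s {struct s} : seq T :=
  if s is x :: s' then (if j is j'.+1 then x :: del j' s' else s') else [::].

Lemma del_catl j s t : (j < size s)%N -> del j (s ++ t) = del j s ++ t.
Proof. by elim: s j => // x s IH [|j] //= /IH ->. Qed.

Lemma del_catr j s t : del (size s + j) (s ++ t) = s ++ del j t.
Proof. by elim: s => //= x s ->. Qed.

(** [bump] is the index shift of minors, which identifies the deletion of a letter with that of a
    row in a cofactor expansion. *)
Lemma nth_del x0 j s k : nth x0 (del j s) k = nth x0 s (bump j k).
Proof.
elim: s j k => [|x s IH] j k; first by rewrite /= !nth_nil.
by case: j => [|j] //=; case: k => [|k] //=; rewrite IH /bump ltnS addnS.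
Qed.

Lemma count_del x0 (a : pred T) j s : (j < size s)%N ->
  count a s = (a (nth x0 s j) + count a (del j s))%N.
Proof. by elim: s j => // x s IH [|j] //= js; rewrite (IH j js) addnCA. Qed.

Lemma pairwise_del (e : rel T) j s : pairwise e s -> pairwise e (del j s).
Proof.
elim: s j => // x s IH [|j] /= /andP[xs es] //; rewrite IH // andbT.
by elim: s j xs {IH es} => // y s IH [|j] /= /andP[xy xs] //; rewrite xy IH.
Qed.

Lemma all_del (a : pred T) j s : all a s -> all a (del j s).
Proof. by elim: s j => // x s IH [|j] /= /andP[ax sa] //; rewrite ax IH. Qed.

Lemma has_split (a : pred T) s : has a s ->
  exists s1 y s2, [/\ s = s1 ++ y :: s2, all (predC a) s1 & a y].
Proof.
elim: s => //= x s IH; have [ax|ax /= /IH[s1 [y [s2 [-> s1a ay]]]]] := boolP (a x).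
  by exists [::], x, s.
by exists (x :: s1), y, s2; rewrite /= ax.
Qed.

End Deletion.

(* The creation operator, if [is_cr], or annihilation operator of the vector
   [vec], inserted at the time [time]. *)
Record letter (C : Type) := Letter { is_cr : bool; time : nat; vec : nat -> C }.

(** * Wick's theorem for traces of time-ordered words *)

Section Wick.
Variables (C : numClosedFieldType) (d : nat) (r : nat -> C).
Local Notation L := (letter C).
Implicit Types (x y : L) (w : seq L) (f v : nat -> C).
Local Notation G := (gam d r).
Local Notation x0 := (Letter false 0 (fun=> 0 : C)).

Definition letter_op x : 'M[C]_(fock_dim d) :=
  if is_cr x then creat d (vec x) else annih d (vec x).

(** The evolution over the times [t0] to [n]: between consecutive letters stands the power of [G]
    given by the time elapsed. *)
Fixpoint word_op n t0 w : 'M[C]_(fock_dim d) :=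
  if w is x :: w' then G ^+ (time x - t0) *m letter_op x *m word_op n (time x) w'
  else G ^+ (n - t0).

(** Under this condition the truncated subtractions in [word_op] are true differences. *)
Fixpoint times_ok n t0 w : bool :=
  if w is x :: w' then (t0 <= time x)%N && times_ok n (time x) w' else (t0 <= n)%N.

Lemma word_op_shift n t0 t1 w : (t0 <= t1)%N -> times_ok n t1 w ->
  G ^+ (t1 - t0) *m word_op n t1 w = word_op n t0 w.
Proof.
have GG a b : G ^+ a *m G ^+ b = G ^+ (a + b) by rewrite mulmxE exprD.
case: w => [|x w] /= t01 => [t1n|/andP[t1n _]]; rewrite ?mulmxA GG.
  by rewrite addnC addnBA // subnK.
by rewrite [(t1 - t0 + _)%N]addnC addnBA // subnK.
Qed.

Lemma word_op_cat n t0 t1 w1 w2 : times_ok t1 t0 w1 -> times_ok n t1 w2 ->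
  word_op n t0 (w1 ++ w2) = word_op t1 t0 w1 *m word_op n t1 w2.
Proof.
elim: w1 t0 => /= [|x w1 IH] t0; first by move=> *; rewrite word_op_shift.
by move=> /andP[t0x w1ok] w2ok; rewrite (IH (time x)) // !mulmxA.
Qed.

Lemma times_ok_le n t0 w : times_ok n t0 w -> (t0 <= n)%N.
Proof. by elim: w t0 => //= x w IH t0 /andP[t0x /IH]; apply: leq_trans. Qed.

Lemma times_ok_nth n t0 w j : times_ok n t0 w -> (j < size w)%N ->
  (t0 <= time (nth x0 w j) <= n)%N.
Proof.
elim: w t0 j => // x w IH t0 [|j] /= /andP[t0x wokx];
  first by rewrite t0x (times_ok_le wokx).
by rewrite ltnS => /(IH _ _ wokx)/andP[/(leq_trans t0x) -> ->].
Qed.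

Lemma times_ok_del n t0 j w : times_ok n t0 w -> times_ok n t0 (del j w).
Proof.
elim: w j t0 => // x w IH [|j] t0 /= /andP[t0x]; last by move/IH ->; rewrite t0x.
by case: w {IH} => [|y w] /=; [exact: leq_trans | case/andP=> /(leq_trans t0x) ->].
Qed.

(** The scalar anticommutator of [annih d v] with the letter. *)
Definition ctr v x : C := if is_cr x then \sum_(i < d) v i * vec x i else 0.

Lemma annih_letter_op v x :
  annih d v *m letter_op x = (ctr v x)%:M - letter_op x *m annih d v.
Proof.
rewrite /letter_op /ctr; case: is_cr; first by rewrite -annih_creat addrK.
by rewrite annih_anticomm raddf0 add0r.
Qed.

(** The annihilation operator travels to the right end: crossing a power of [G] multiplies [v] by
    that power of [r], crossing a letter costs a sign and leaves a term in which that letter is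
    contracted and deleted. *)
Lemma annih_word_op n t0 v w : times_ok n t0 w ->
  annih d v *m word_op n t0 w =
  \sum_(j < size w) ((-1) ^+ j * ctr (fun i => r i ^+ (time (nth x0 w j) - t0)
    * v i)
     (nth x0 w j)) *: word_op n t0 (del j w) +
  (-1) ^+ size w *: (word_op n t0 w *m annih d (fun i => r i ^+ (n - t0) * v i)).
Proof.
elim: w t0 v => [|x w IH] t0 v /=.
  by move=> t0n; rewrite big_ord0 add0r scale1r annih_gamX.
move=> /andP[t0x wokx]; rewrite !mulmxA annih_gamX -!(mulmxA (G ^+ _)).
rewrite annih_letter_op mulmxBl mulmxBr mul_scalar_mx -scalemxAr word_op_shift //.
rewrite big_ord_recl expr0 mul1r -addrA; congr (_ + _).
rewrite -[letter_op x *m _ *m word_op _ _ _]mulmxA.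
rewrite IH // !mulmxDr opprD; congr (_ + _).
  rewrite !mulmx_sumr -sumrN; apply: eq_bigr => j _ /=.
  rewrite -!scalemxAr -scaleNr !mulmxA exprS mulN1r mulNr.
  congr (- (_ * _) *: _); rewrite /ctr; case: ifP => // _.
  apply: eq_bigr => i _; congr (_ * _); rewrite mulrA -exprD.
  congr (_ ^+ _ * _).
  by rewrite add0n; have := times_ok_nth wokx (ltn_ord j); lia.
rewrite -!scalemxAr -scaleNr exprS mulN1r !mulmxA; congr (_ *: (_ *m _)).
apply: annih_ext => i _; rewrite mulrA -exprD; congr (_ ^+ _ * _).
by have := times_ok_le wokx; lia.
Qed.


(* An annihilation letter [y] precedes the creation letters at the same time. *)
Definition propagator n y x : C :=
  if is_cr x then \sum_(i < d) vec y i * vec x i *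
    (if (time x < time y)%N then - r i ^+ (n - (time y - time x))
     else r i ^+ (time x - time y)) / (1 + r i ^+ n)
  else 0.

(* The letter [y] is moved to the right, round the trace and back. *)
Lemma wick_step n w1 y w2 : (forall i, 1 + r i ^+ n != 0) -> ~~ is_cr y -> odd
  (size (w1 ++ w2)) ->
    times_ok (time y) 0 w1 -> times_ok n (time y) w2 ->
    all (fun x => (time x < time y)%N) w1 ->
  \tr (word_op n 0 (w1 ++ y :: w2)) = (-1) ^+ size w1 *
   \sum_(j < size (w1 ++ w2)) (-1) ^+ j * propagator n y (nth x0 (w1 ++ w2) j) *
     \tr (word_op n 0 (del j (w1 ++ w2))).
Proof.
move=> r_unit ycr oddw ok1 ok2 /all_nthP w1y.
set t := time y in ok1 ok2 w1y *.
(* Chosen so that [vec y = v + r^n v]. Since the word is odd, [annih d v] returns from its way round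
   the trace as [- annih d (r^n v)], which cancels the second summand and leaves only the
   contractions. *)
pose v i := vec y i / (1 + r i ^+ n).
have tn := times_ok_le ok2.
have -> : \tr (word_op n 0 (w1 ++ y :: w2)) =
    \tr (annih d (vec y) *m (word_op n t w2 *m word_op t 0 w1)).
  rewrite (@word_op_cat _ _ t) //= ?leqnn //.
  by rewrite subnn expr0 mul1mx mxtrace_mulC /letter_op (negbTE ycr) !mulmxA.
have -> : annih d (vec y) = annih d v + annih d (fun i => r i ^+ n * v i).
  rewrite -annihD; apply: annih_ext => i _.
  by rewrite /v; have := r_unit i; move: (r i ^+ n) => a a1; field.
rewrite mulmxDl raddfD /= [annih d v *m _]mulmxA annih_word_op // mulmxDl.
rewrite -scalemxAl -[_ *m annih d _ *m _]mulmxA annih_word_op // mulmxDr.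
rewrite -scalemxAr [_ *m (word_op t 0 w1 *m _)]mulmxA scalerDr scalerA.
have -> : annih d (fun i => r i ^+ (t - 0) * (r i ^+ (n - t) * v i)) =
          annih d (fun i => r i ^+ n * v i).
  by apply: annih_ext => i _; rewrite mulrA -exprD subn0 subnKC.
have e21 : (-1) ^+ size w2 * (-1) ^+ size w1 = -1 :> C.
  by rewrite -exprD addnC -size_cat -signr_odd oddw.
have e2 : (-1) ^+ size w2 = - (-1) ^+ size w1 :> C.
  apply: (@mulIf _ ((-1) ^+ size w1)); first by rewrite signr_eq0.
  by rewrite e21 mulNr -expr2 sqrr_sign.
rewrite e21 e2 !raddfD /= scaleN1r [\tr (- _)]raddfN /=.
rewrite [\tr (annih _ _ *m _)]mxtrace_mulC addrA subrK.
rewrite mulmx_suml mulmx_sumr !mxtraceZ !raddf_sum /= mulNr.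
rewrite size_cat big_split_ord /= mulrDr addrC; congr (_ + _).
  rewrite -mulrN -sumrN; congr (_ * _); apply: eq_bigr => j _.
  rewrite -scalemxAr mxtraceZ nth_cat ltn_ord -mulNr -mulrN; congr (_ * _ * _).
    rewrite /ctr /propagator; case: ifP => _; last by rewrite oppr0.
    rewrite -sumrN; apply: eq_bigr => i _.
    have tj := w1y x0 j (ltn_ord j); rewrite tj.
    have -> : (n - (t - time (nth x0 w1 j)) = time (nth x0 w1 j) - 0 + (n -
      t))%N by lia.
    by rewrite exprD /v; ring.
  rewrite del_catl ?ltn_ord // mxtrace_mulC -word_op_cat //; exact: times_ok_del.
rewrite mulr_sumr; apply: eq_bigr => j _.
rewrite -scalemxAl mxtraceZ nth_cat ltnNge leq_addr /= addKn.
rewrite exprD -!mulrA signrMK !mulrA; congr (_ * _ * _).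
  rewrite /ctr /propagator; case: ifP => // _; apply: eq_bigr => i _.
  have /andP[tj _] := times_ok_nth ok2 (ltn_ord j).
  by rewrite ltnNge tj /= /v; ring.
rewrite del_catr mxtrace_mulC -word_op_cat //; exact: times_ok_del.
Qed.

Definition lpre x y := (time x < time y)%N ||
  ((time x == time y) && (is_cr x ==> is_cr y)).

Definition lsorted n w :=
  pairwise lpre w && all (fun x => time x <= n)%N w.

Lemma lsorted_times_ok n t0 w : (t0 <= n)%N -> all (fun x => t0 <= time x)%N w ->
  lsorted n w -> times_ok n t0 w.
Proof.
elim: w t0 => //= x w IH t0 t0n /andP[t0x _] /andP[/andP[xw sw] /andP[xn wn]].
rewrite t0x; apply: IH => //; last by apply/andP.
apply: sub_all xw => y; by case/orP => [/ltnW //|/andP[/eqP -> //]].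
Qed.

(** The sign of the shuffle that moves all annihilation letters in front of the creation letters. *)
Fixpoint wsign w : C :=
  if w is x :: w' then
    (if is_cr x then (-1) ^+ count (predC (@is_cr C)) w' else 1) * wsign w'
  else 1.

Lemma norm_wsign w : `|wsign w| = 1.
Proof.
elim: w => [|x w IH] /=; first by rewrite normr1.
by rewrite normrM IH mulr1; case: is_cr; rewrite ?normr_sign ?normr1.
Qed.

(** Deleting this letter removes from the sign the annihilation letters after it, while [j] counts
    those before it together with the earlier creation letters. *)
Lemma wsign_cr j w : (j < size w)%N -> is_cr (nth x0 w j) ->
  (-1) ^+ j * wsign (del j w) =
  (-1) ^+ count (predC (@is_cr C)) w * (-1) ^+ count (@is_cr C) (take j w) *
    wsign w.
Proof.
elim: w j => // x w IH [|j] /=; rewrite ?ltnS => jw.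
  by move=> xcr; rewrite xcr mul1r add0n mulr1 signrMK.
move=> crj; rewrite (count_del x0 _ jw) /= crj add0n.
case: (is_cr x) => /=.
  rewrite exprS mulN1r mulrCA mulNr IH //.
  rewrite (count_del x0 _ jw) /= crj add0n !exprD; ring.
rewrite !mul1r exprS -mulrA IH // (count_del x0 _ jw) /= crj !add0n exprS; ring.
Qed.

Lemma wsign_an w1 y w2 : all (@is_cr C) w1 -> ~~ is_cr y ->
  wsign (w1 ++ y :: w2) = (-1) ^+ size w1 * wsign (w1 ++ w2).
Proof.
elim: w1 => [|x w1 IH] /=; first by move=> _ /negbTE ->.
move=> /andP[xcr crw] yan; rewrite xcr IH // !count_cat /= yan add1n addnS
  exprS exprS.
ring.
Qed.

Definition ldet n N rows cols :=
  \det (\matrix_(i < N, j < N) propagator n (nth x0 cols j) (nth x0 rows i)).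

Lemma ldet_expand n N rows y cols :
  ldet n N.+1 rows (y :: cols) =
  \sum_(i < N.+1) (-1) ^+ i * propagator n y (nth x0 rows i) * ldet n N (del i
    rows) cols.
Proof.
rewrite /ldet (expand_det_col _ ord0); apply: eq_bigr => i _.
rewrite mxE /= /cofactor addn0 mulrCA mulrA; congr (_ * _).
rewrite /ldet; congr (\det _); apply/matrixP => a b; rewrite !mxE /=.
by rewrite nth_del.
Qed.

(** For matching the sum over all letters in [wick_step] with a Laplace expansion, whose rows are
    the creation letters alone. *)
Lemma sum_filter (T : Type) (z : T) (a : pred T) (F : nat -> T -> C) s :
  \sum_(j < size s) (if a (nth z s j) then F (count a (take j s)) (nth z s j)
    else 0) =
  \sum_(i < size (seq.filter a s)) F i (nth z (seq.filter a s) i).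
Proof.
elim: s F => [|x s IH] F /=; first by rewrite !big_ord0.
rewrite big_ord_recl /=; case: (a x) => /=; last by rewrite add0r -(IH F).
by rewrite big_ord_recl -(IH (fun k => F k.+1)).
Qed.

Lemma filter_del_nth (T : Type) (z : T) (a : pred T) s j :
  (j < size s)%N -> a (nth z s j) ->
  seq.filter a (del j s) = del (count a (take j s)) (seq.filter a s).
Proof.
elim: s j => // x s IH [|j] /= js aj; first by rewrite aj.
by rewrite (IH j) //; case: (a x).
Qed.

Lemma filter_del_nthN (T : Type) (z : T) (a : pred T) s j :
  (j < size s)%N -> ~~ a (nth z s j) -> seq.filter a (del j s) = seq.filter a s.
Proof.
elim: s j => // x s IH [|j] /= js aj; first by rewrite (negbTE aj).
by rewrite (IH j).
Qed.

(** Induction on [N]: [wick_step] at the first annihilation letter is the expansion of the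
    determinant along its first column. By [wsign_cr] each step contributes the number of remaining
    annihilation letters to the sign, in total ['C(N, 2)]. *)
Theorem wick n N w : (forall i, 1 + r i ^+ n != 0) -> lsorted n w -> count
  (@is_cr C) w = N ->
    count (predC (@is_cr C)) w = N ->
  \tr (word_op n 0 w) = (-1) ^+ 'C(N, 2) * wsign w * \tr (G ^+ n) *
    ldet n N (seq.filter (@is_cr C) w) (seq.filter (predC (@is_cr C)) w).
Proof.
move=> r_unit; elim: N w => [|N IH] w sw ccr can.
  have -> : w = [::].
    by apply/size0nil; rewrite -(count_predC (@is_cr C)) ccr can.
  by rewrite /= subn0 /ldet det_mx00 !mulr1 mul1r.
have /has_split[w1 [y [w2 [wE w1cr yan]]]] : has (predC (@is_cr C)) w.
  by rewrite has_count can.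
have {}yan : ~~ is_cr y := yan.
have {}w1cr : all (@is_cr C) w1.
  by apply: sub_all w1cr => x /=; rewrite negbK.
set w' := w1 ++ w2.
move: sw ccr can; rewrite wE => /andP[].
rewrite pairwise_cat allrel_consr /= all_cat /=.
move=> /and3P[/andP[w1y w12] pw1 /andP[yw2 pw2]] /and3P[w1n yn w2n].
rewrite !count_cat /= (negbTE yan) add0n => ccr can.
have ccr' : count (@is_cr C) w' = N.+1 by rewrite count_cat.
have can' : count (predC (@is_cr C)) w' = N.
  by rewrite count_cat; apply/eqP; rewrite -eqSS -can addnS.
have sw' : lsorted n w'.
  by rewrite /lsorted pairwise_cat all_cat w12 pw1 pw2 w1n.
(* A creation letter at the time of [y] would stand after [y], hence the strict inequality. *)
have w1lt : all (fun x => time x < time y)%N w1.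
  have : all (predI (@is_cr C) (lpre^~ y)) w1 by rewrite all_predI w1cr.
  by apply: sub_all => x /= /andP[xcr]; rewrite /lpre xcr (negbTE yan) andbF orbF.
have ok1 : times_ok (time y) 0 w1.
  apply: lsorted_times_ok => //; first by rewrite (@eq_all _ _ predT) ?all_predT.
  by rewrite /lsorted pw1; apply: sub_all w1lt => x /ltnW.
have ok2 : times_ok n (time y) w2.
  apply: lsorted_times_ok => //; last by rewrite /lsorted pw2.
  by apply: sub_all yw2 => x /orP[/ltnW //|/andP[/eqP ->]].
have odd_w' : odd (size w').
  by rewrite -(count_predC (@is_cr C)) ccr' can' oddD /= addNb addbb.
rewrite wick_step // -/w' wsign_an // -/w' !filter_cat /= (negbTE yan) /=.
have an1 : seq.filter (predC (@is_cr C)) w1 = [::].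
  by apply/size0nil; rewrite size_filter; apply/eqP;
    rewrite -leqn0 leqNgt -has_count has_predC w1cr.
rewrite an1 cat0s -filter_cat -/w'.
have an2 : seq.filter (predC (@is_cr C)) w2 = seq.filter (predC (@is_cr C)) w'.
  by rewrite filter_cat an1.
rewrite an2 ldet_expand.
set rows := seq.filter _ w'; set cols := seq.filter _ w'.
pose F i x := (-1) ^+ i * propagator n y x * ldet n N (del i rows) cols.
have szr : size rows = N.+1 by rewrite size_filter.
have -> : \sum_(i < N.+1) (-1) ^+ i * propagator n y (nth x0 rows i) *
    ldet n N (del i rows) cols =
  \sum_(j < size w') (if is_cr (nth x0 w' j)
    then F (count (@is_cr C) (take j w')) (nth x0 w' j) else 0).
  by rewrite (sum_filter x0 (@is_cr C) F) -/rows szr.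
rewrite mulr_sumr [RHS]mulr_sumr; apply: eq_bigr => j _; have jw := ltn_ord j.
case: ifP => crj; last by rewrite /propagator crj !(mulr0, mul0r).
have [cc ca] := (count_del x0 (@is_cr C) jw, count_del x0 (predC (@is_cr C)) jw).
have sj : lsorted n (del j w').
  by case/andP: sw' => pw' aw'; rewrite /lsorted pairwise_del ?all_del.
have fa : seq.filter (predC (@is_cr C)) (del j w') = cols.
  by apply: (@filter_del_nthN _ x0 _ _ _ jw); rewrite /= crj.
rewrite IH // ?(filter_del_nth jw crj) ?fa.
  rewrite -/rows -/cols /F binS bin1 exprD.
  have := wsign_cr jw crj; rewrite can' => sE.
  rewrite [LHS](_ : _ = (-1) ^+ size w1 * (-1) ^+ 'C(N, 2) * \tr (G ^+ n) *
    propagator n y (nth x0 w' j) * ldet n N (del (count (@is_cr C) (take j w'))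
      rows) cols *
    ((-1) ^+ j * wsign (del j w'))); last by ring.
  by rewrite sE; ring.
- by apply/eqP; rewrite -eqSS -ccr' cc crj.
- by rewrite -can' ca /= crj.
Qed.

End Wick.

(** * The determinant bound for a real diagonal one-step operator *)

Section TwoPoint.
Variables (C : numClosedFieldType) (d : nat) (r : nat -> C).
Local Notation G := (gam d r).

Definition lbounded (x : letter C) := \sum_(i < d) `|vec x i| ^+ 2 <= 1.

Lemma contraction_letter_op x : lbounded x -> contraction (letter_op d x).
Proof.
by move=> x1; rewrite /letter_op; case: is_cr;
  [apply: contraction_creat|apply: contraction_annih].
Qed.

(** One contraction per time step: letters at the same time are multiplied together and a time
    without letters contributes 1. Those at time [t0] have no [G] before them and make up [X]. *)
Lemma word_op_prod n t0 w : times_ok n t0 w -> all lbounded w ->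
  exists X (s : seq 'M[C]_(fock_dim d)),
    [/\ contraction X, {in s, forall Y, contraction Y}, size s = (n - t0)%N
      & word_op d r n t0 w = X *m \prod_(Y <- s) (G *m Y)].
Proof.
have prod_nseq k : \prod_(Y <- nseq k (1%:M : 'M[C]_(fock_dim d))) (G *m Y) = G
  ^+ k.
  elim: k => [|k IH]; first by rewrite big_nil.
  by rewrite /= big_cons IH mulmx1 exprS.
elim: w t0 => [|x w IH] t0 /=.
  exists 1%:M, (nseq (n - t0) 1%:M); split; rewrite ?size_nseq //.
  - exact: contraction1.
  - by move=> Y /nseqP[-> _]; apply: contraction1.
  - by rewrite mul1mx prod_nseq.
move=> /andP[t0x okw] /andP[/contraction_letter_op cx /(IH _ okw)[X [s [cX cs
  szs ->]]]].
have xn := times_ok_le okw.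
case: (posnP (time x - t0)) => [k0|k0].
  exists (letter_op d x *m X), s; split=> //; [exact: contractionM|lia|].
  by rewrite k0 expr0 mul1mx mulmxA.
exists 1%:M, (nseq (time x - t0).-1 1%:M ++ (letter_op d x *m X) :: s); split.
- exact: contraction1.
- move=> Y; rewrite mem_cat inE => /orP[/nseqP[-> _]|/orP[/eqP ->|/cs //]].
    exact: contraction1.
  exact: contractionM.
- by rewrite size_cat size_nseq /= szs; lia.
rewrite mul1mx big_cat big_cons /= prod_nseq -[in LHS](prednK k0) exprSr.
by rewrite -!mulmxE !mulmxA.
Qed.

Hypothesis r_real : forall i, r i \is Num.real.

Lemma word_op_trace_le m w : (0 < m)%N -> times_ok m.*2 0 w -> all lbounded w ->
  `|\tr (word_op d r m.*2 0 w)| <= `|\tr (G ^+ m.*2)|.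
Proof.
move=> m0 okw bw; have [X [s [cX cs szs ->]]] := word_op_prod okw bw.
rewrite subn0 in szs; case/lastP: s => [|s Y] in cs szs *.
  by move: szs m0 => /=; lia.
rewrite -cats1 big_cat big_cons big_nil /= mulr1.
(* Cyclicity absorbs [X] into the last factor, leaving exactly [m.*2] factors of the form [G Z]. *)
rewrite mxtrace_mulC -mulmxA -[(G *m Y) *m X]mulmxA.
have := @trace_prod_le C _ G m (rcons s (Y *m X)) (adj_gam _ r_real).
rewrite -cats1 big_cat big_cons big_nil /= mulr1; apply => //.
  move=> Z; rewrite mem_cat inE => /orP[Zs|/eqP ->].
    by apply: cs; rewrite mem_rcons inE Zs orbT.
  by apply: contractionM => //; apply: cs; rewrite mem_rcons inE eqxx.
by move: szs; rewrite size_rcons size_cat addn1.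
Qed.

Lemma det_perm_norm N (A : 'M[C]_N) (s t : 'S_N) :
  `|\det (row_perm s (col_perm t A))| = `|\det A|.
Proof.
by rewrite row_permE col_permE !det_mulmx !det_perm !normrM !normr_sign mul1r mulr1.
Qed.

Lemma sort_enum_perm N (T : Type) (e : rel T) (f : 'I_N -> T) :
  exists s : 'S_N, sort e [seq f i | i <- enum 'I_N] = [seq f (s i) | i <- enum
    'I_N].
Proof.
rewrite sort_map; set l := sort _ _.
have pl : perm_eq l (enum 'I_N) by rewrite perm_sort.
have szl : size l = N by rewrite (perm_size pl) size_enum_ord.
case: N => [|N] in e f l pl szl *.
  by exists 1%g; rewrite [l]size0nil // [enum _]size0nil // size_enum_ord.
pose s (i : 'I_N.+1) := nth ord0 l i.
have s_inj : injective s.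
  move=> i j /eqP; rewrite nth_uniq ?szl // ?(perm_uniq pl) ?enum_uniq //.
  by move/eqP/val_inj.
exists (perm s_inj); rewrite -[l in LHS](mkseq_nth ord0) /mkseq szl -val_enum_ord.
by rewrite -!map_comp; apply: eq_map => i /=; rewrite permE.
Qed.

(* Minus the covariance between the times [a] and [b] of a Hamiltonian acting as
   the scalar [h], with [x = 1 - (beta/n) h]. *)
Definition twopt n (a b : nat) (x : C) : C :=
  (if (a <= b)%N then - x ^+ (n - (b.+1 - a)) else x ^+ (a - b.+1)) / (1 + x ^+ n).

(** The matrix is, up to permutations of rows and columns, that of [wick] for the letters sorted by
    time; the bound on the trace of the word is then divided by [\tr (G ^+ n)], which is
    positive. *)
Lemma twopt_det_bound m N (a b : 'I_N -> nat) (u v : 'I_N -> nat -> C) :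
    (0 < m)%N -> (forall k, a k < m.*2)%N -> (forall l, b l < m.*2)%N ->
    (forall k, \sum_(i < d) `|u k i| ^+ 2 <= 1) ->
    (forall l, \sum_(i < d) `|v l i| ^+ 2 <= 1) ->
  `|\det (\matrix_(k < N, l < N)
      \sum_(i < d) v l i * u k i * twopt m.*2 (a k) (b l) (r i))| <= 1.
Proof.
move=> m0 an bn u1 v1; set n := m.*2.
(* The evenness of [n] enters here: [r i] may be negative, [r i ^+ n] may not. *)
have rn0 i : 0 <= r i ^+ n by rewrite /n -mul2n exprM exprn_ge0 // -realEsqr.
have r_unit i : 1 + r i ^+ n != 0 by rewrite gt_eqF // ltr_wpDr.
(* The annihilation letters are placed at [b l + 1]: the case [a k <= b l] of [twopt] becomes the
   strict comparison in [propagator]. *)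
pose cl k := Letter true (a k) (u k).
pose al l := Letter false (b l).+1 (v l).
pose w0 := [seq cl k | k <- enum 'I_N] ++ [seq al l | l <- enum 'I_N].
have lpre_tot : total (@lpre C).
  move=> x y; rewrite /lpre; case: ltngtP => //= _.
  by case: (is_cr x); case: (is_cr y).
have lpre_tr : transitive (@lpre C).
  move=> y x z; rewrite /lpre.
  case: (ltngtP (time x) (time y)) => //= [xy _|xy].
    case: (ltngtP (time y) (time z)) => //= [yz _|yz _];
      rewrite ?yz ?(ltn_trans xy yz) //.
    by rewrite -yz xy.
  rewrite xy; case: (ltngtP (time y) (time z)) => //= _.
  by case: (is_cr x); case: (is_cr y).
set w := sort (@lpre C) w0.
have all_w (p : pred (letter C)) : all p w0 -> all p w.
  by rewrite !all_count count_sort size_sort.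
have sw : lsorted n w.
  rewrite /lsorted -sorted_pairwise ?sort_sorted //=; apply: all_w.
  by rewrite all_cat !all_map; apply/andP; split; apply/allP => k _ /=;
    rewrite ?bn // ltnW ?an.
have bw : all lbounded w.
  by apply: all_w; rewrite all_cat !all_map; apply/andP; split;
    apply/allP => k _ /=; rewrite /lbounded /= ?u1 ?v1.
have fcr : seq.filter (@is_cr C) w0 = [seq cl k | k <- enum 'I_N].
  by rewrite filter_cat !filter_map (@eq_filter _ _ predT) // filter_predT
    (@eq_filter _ _ pred0) // filter_pred0 cats0.
have fan : seq.filter (predC (@is_cr C)) w0 = [seq al k | k <- enum 'I_N].
  by rewrite filter_cat !filter_map (@eq_filter _ _ pred0) // filter_pred0
    (@eq_filter _ _ predT) // filter_predT.
have [s sE] := sort_enum_perm (@lpre C) cl.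
have [t tE] := sort_enum_perm (@lpre C) al.
have Z0 : 0 < \tr (G ^+ n).
  by rewrite gamX mxtrace_gam prodr_gt0 // => i _; rewrite ltr_wpDr.
have ccr : count (@is_cr C) w = N.
  by rewrite count_sort -size_filter fcr size_map size_enum_ord.
have can : count (predC (@is_cr C)) w = N.
  by rewrite count_sort -size_filter fan size_map size_enum_ord.
have := word_op_trace_le m0 (lsorted_times_ok (leq0n _) _ sw) bw.
rewrite (@eq_all _ _ predT) // all_predT => /(_ isT).
rewrite (wick _ r_unit sw ccr can) !normrM normr_sign norm_wsign !mul1r.
rewrite mulrC ger_pMl ?normr_gt0 ?gt_eqF //.
rewrite !filter_sort // fcr fan sE tE; apply: le_trans.
rewrite -(det_perm_norm _ s t) le_eqVlt; apply/orP; left; apply/eqP.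
congr (`|\det _|); apply/matrixP => k l; rewrite !mxE.
have nthE (f : 'I_N -> letter C) (i : 'I_N) x :
    nth x [seq f j | j <- enum 'I_N] i = f i.
  by rewrite (nth_map i) ?size_enum_ord // nth_ord_enum.
rewrite !nthE /propagator /=.
by apply: eq_bigr => i _; rewrite /twopt ltnS mulrA.
Qed.

End TwoPoint.

(** * Bounds for vectors of arbitrary norm, and Hermitian matrices *)

Section FiniteDimensional.
Variable C : numClosedFieldType.

Lemma twopt_det_scaled (I : finType) (r : I -> C) m N (a b : 'I_N -> nat)
    (u v : 'I_N -> I -> C) :
    (forall i, r i \is Num.real) ->
    (0 < m)%N -> (forall k, a k < m.*2)%N -> (forall l, b l < m.*2)%N ->
  `|\det (\matrix_(k < N, l < N)
      \sum_i v l i * u k i * twopt m.*2 (a k) (b l) (r i))| <=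
  (\prod_k sqrtC (\sum_i `|u k i| ^+ 2)) * \prod_l sqrtC (\sum_i `|v l i| ^+ 2).
Proof.
move=> rR m0 an bn.
pose nrm (w : I -> C) := sqrtC (\sum_i `|w i| ^+ 2).
have sum_ge0 (w : I -> C) : 0 <= \sum_i `|w i| ^+ 2.
  by apply: sumr_ge0 => i _; rewrite exprn_ge0.
have nrm_ge0 w : 0 <= nrm w by rewrite sqrtC_ge0.
have nrm0 w i : nrm w = 0 -> w i = 0.
  move/eqP; rewrite sqrtC_eq0 psumr_eq0 => [/allP/(_ i)|j _]; last exact: exprn_ge0.
  by rewrite mem_index_enum => /(_ isT)/= /eqP/eqP;
    rewrite sqrf_eq0 normr_eq0 => /eqP.
(* A vector of norm 0 vanishes and is normalized to 0, since [x / 0 = 0]. *)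
pose unit (w : I -> C) i := w i / nrm w.
have unitE w i : w i = nrm w * unit w i.
  have [w0|w0] := eqVneq (nrm w) 0; first by rewrite w0 mul0r nrm0.
  by rewrite /unit mulrC divfK.
have unit1 w : \sum_i `|unit w i| ^+ 2 <= 1.
  under eq_bigr do rewrite /unit normrM exprMn normfV exprVn.
  rewrite -mulr_suml (ger0_norm (nrm_ge0 w)) sqrtCK.
  have [->|s0] := eqVneq (\sum_i `|w i| ^+ 2) 0; first by rewrite mul0r.
  by rewrite divff.
pose ev (w : I -> C) (i : nat) : C :=
  if (insub i : option 'I_#|I|) is Some j then w (enum_val j) else 0.
have evE w (i : 'I_#|I|) : ev w i = w (enum_val i) by rewrite /ev valK.
have evR i : ev r i \is Num.real by rewrite /ev; case: insub => // j; apply: rR.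
have sumE (F : I -> C) : \sum_i F i = \sum_(i < #|I|) F (enum_val i).
  by rewrite -(big_enum_val F).
have ev1 w : \sum_(i < #|I|) `|ev (unit w) i| ^+ 2 <= 1.
  by under eq_bigr do rewrite evE; rewrite -(sumE (fun i => `|unit w i| ^+ 2)).
have := @twopt_det_bound C #|I| (ev r) evR m N a b (fun k => ev (unit (u k)))
  (fun l => ev (unit (v l))) m0 an bn (fun=> ev1 _) (fun=> ev1 _).
set M := \matrix_(k, l) _ => M1.
have -> : \matrix_(k < N, l < N) (\sum_i v l i * u k i * twopt m.*2 (a k) (b l)
  (r i))
    = diag_mx (\row_k nrm (u k)) *m M *m diag_mx (\row_l nrm (v l)).
  apply/matrixP => k l; rewrite mul_mx_diag mul_diag_mx !mxE sumE mulr_sumr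
    mulr_suml.
  apply: eq_bigr => i _; rewrite !evE (unitE (v l)) (unitE (u k)); ring.
rewrite !det_mulmx !det_diag.
under eq_bigr do rewrite mxE; under [X in _ * X]eq_bigr do rewrite mxE.
rewrite !normrM !normr_prod.
under eq_bigr do rewrite ger0_norm //;
  under [X in _ * X]eq_bigr do rewrite ger0_norm //.
rewrite mulrAC ler_piMr // mulr_ge0 //; exact: prodr_ge0.
Qed.

Lemma hermitian_diagonalization n (K : 'M[C]_n) : K^t* = K ->
  exists (P : 'M[C]_n) (D : 'I_n -> C), [/\ P *m P^t* = 1%:M,
    K = P^t* *m diag_mx (\row_i D i) *m P & forall i, D i \is Num.real].
Proof.
move=> adjK; have hK : K \is hermsymmx by rewrite qualifE /= expr0 scale1r adjK.
exists (spectralmx K), (spectral_diag K 0); split.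
- exact/unitarymxP/spectral_unitarymx.
- rewrite -(invmx_unitary (spectral_unitarymx K)).
  rewrite [in diag_mx _](_ : \row_i _ = spectral_diag K).
    exact/orthomx_spectralP/hermitian_normalmx.
  by apply/rowP => i; rewrite mxE.
- by move=> i; have /mxOverP := hermitian_spectral_diag_real hK.
Qed.

Lemma psd_factor n (K : 'M[C]_n) : K^t* = K ->
  (forall x : 'rV[C]_n, 0 <= (x *m K *m x^t*) 0 0) ->
  exists Y : 'M[C]_n, K = Y *m Y^t*.
Proof.
move=> adjK psdK; have [P [D [PP KE _]]] := hermitian_diagonalization adjK.
have DE : diag_mx (\row_i D i) = P *m K *m P^t*.
  by rewrite KE !mulmxA PP mul1mx -mulmxA PP mulmx1.
have D0 i : 0 <= D i.
  have <- : (row i P *m K *m (row i P)^t*) 0 0 = D i.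
    have -> : D i = diag_mx (\row_i D i) i i by rewrite !mxE eqxx.
    rewrite DE -!row_mul !mxE; apply: eq_bigr => j _; by rewrite !mxE.
  exact: psdK.
exists (P^t* *m diag_mx (\row_i sqrtC (D i))).
rewrite adjmxM trmxCK {1}KE !mulmxA; congr (_ *m _); rewrite -mulmxA;
  congr (_ *m _).
rewrite tr_diag_mx map_diag_mx mul_diag_mx; apply/matrixP => i j; rewrite !mxE.
case: eqVneq => [->|_]; rewrite ?mulr0n ?mulr0 ?mulr1n //.
rewrite [X in _ * X](_ : _ = sqrtC (D j)) -?expr2 ?sqrtCK //.
by apply/CrealP; rewrite ger0_real // sqrtC_ge0.
Qed.

(* The solution is [P B + (P B)^* - P B P] with [P] the orthogonal projection on
   the row space of [X0] and [X0 B = X1]. *)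
Lemma hermitian_extension p n (X0 X1 : 'M[C]_(p, n)) :
    X0 *m X1^t* = X1 *m X0^t* ->
    (forall c : 'rV[C]_p, c *m X0 = 0 -> c *m X1 = 0) ->
  exists2 H : 'M[C]_n, H^t* = H & X0 *m H = X1.
Proof.
move=> symX kerX; have [B XB] : exists B, X0 *m B = X1.
  (* With [X0^+] the pseudoinverse, the rows of [1 - X0 X0^+] annihilate [X0], hence [X1] by
     [kerX]. *)
  exists (pinvmx X0 *m X1).
  apply/eqP; rewrite -subr_eq0 -oppr_eq0 opprB; apply/eqP/row_matrixP => i.
  rewrite row0 mulmxA -{1}[X1]mul1mx -mulmxBl row_mul; apply: kerX.
  by rewrite -row_mul mulmxBl mul1mx mulmxKpV ?submx_refl // subrr row0.
pose P := proj_ortho X0.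
have XP : X0 *m P = X0 by apply: proj_ortho_id.
have [T PE] : exists T, P = T *m X0.
  by apply/submxP; rewrite -[P]mul1mx proj_ortho_sub.
have adjP : P^t* = P.
  have PPt : P^t* = P *m P^t*.
    have := proj_ortho_compl_sub X0 (1%:M : 'M[C]_n).
    rewrite mul1mx -/P => /orthomx1P o.
    apply/eqP; rewrite -subr_eq0 -{1}[P^t*]mul1mx -mulmxBl {2}PE adjmxM mulmxA o.
    by rewrite mul0mx.
  by rewrite [LHS]PPt -{1}[P]trmxCK -adjmxM -PPt trmxCK.
(* This is [symX] in terms of [B]; as [P] factors through [X0], it makes [P B P] Hermitian. *)
have adjXB : X0 *m B *m X0^t* = X0 *m B^t* *m X0^t*.
  by rewrite XB -symX -XB adjmxM mulmxA.
clearbody P; have PBPE A : P *m A *m P = T *m (X0 *m A *m X0^t*) *m T^t*.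
  by rewrite {1}PE -adjP PE adjmxM !mulmxA.
have adjPBP : (P *m B *m P)^t* = P *m B *m P.
  by rewrite !adjmxM adjP mulmxA (PBPE (B^t*)) (PBPE B) adjXB.
exists (P *m B + (P *m B)^t* - P *m B *m P).
  by rewrite adjmxD adjmxD trmxCK linearN /= map_mxN adjPBP [X in X - _]addrC.
rewrite mulmxBr mulmxDr !mulmxA XP XB adjmxM adjP.
suff -> : X0 *m (B^t* *m P) = X1 *m P by rewrite addrK.
by rewrite -adjP PE adjmxM !mulmxA -adjXB XB.
Qed.

End FiniteDimensional.

(** * Coordinates for finitely many orbits of a symmetric operator *)

Section Krylov.
Variables (C : numClosedFieldType) (V : lmodType C) (dot : {dot V for Num.conj}).

Lemma dotC x y : dot x y = (dot y x)^*.
Proof. by rewrite hermC expr0 mul1r. Qed.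

Lemma dot_sumZl (J : finType) (w : J -> C) (z : J -> V) y :
  dot (\sum_j w j *: z j) y = \sum_j w j * dot (z j) y.
Proof. by rewrite linear_sumlz; apply: eq_bigr => j _; rewrite linearZl_LR. Qed.

Lemma dot_sumZr (J : finType) (w : J -> C) (z : J -> V) x :
  dot x (\sum_j w j *: z j) = \sum_j (w j)^* * dot x (z j).
Proof. by rewrite linear_sumr; apply: eq_bigr => j _; rewrite linearZr_LR. Qed.

(** A Gram matrix is positive semidefinite, hence of the form [Y Y^*]; the rows of [Y] reproduce the
    scalar products. *)
Lemma gram_coordinates (T : finType) (z : T -> V) :
  exists y : T -> 'rV[C]_#|T|, forall p q, dot (z p) (z q) = (y p *m (y q)^t*) 0 0.
Proof.
pose e (i : 'I_#|T|) := z (enum_val i).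
have adjK : (\matrix_(i, j) dot (e i) (e j))^t* = \matrix_(i, j) dot (e i) (e j).
  by apply/matrixP => i j; rewrite !mxE [RHS]dotC.
have [x|Y YE] := psd_factor adjK.
  rewrite [leRHS](_ : _ = dot (\sum_j x 0 j *: e j) (\sum_j x 0 j *: e j))
    ?dnorm_ge0 //.
  rewrite dot_sumZr mxE; apply: eq_bigr => j _; rewrite !mxE mulrC; congr (_ * _).
  by rewrite dot_sumZl; apply: eq_bigr => i _; rewrite mxE.
exists (fun p => row (enum_rank p) Y) => p q.
have /matrixP/(_ (enum_rank p) (enum_rank q)) := YE.
rewrite mxE /e !enum_rankK => ->; rewrite !mxE; apply: eq_bigr => i _.
by rewrite !mxE.
Qed.

(** The norm of a combination depends on the scalar products only, so both families satisfy the same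
    linear relations. *)
Lemma gram_kernel (T J : finType) (z : T -> V) s (y : T -> 'rV[C]_s) (h : J -> T)
    (w : J -> C) :
  (forall p q, dot (z p) (z q) = (y p *m (y q)^t*) 0 0) ->
  (\sum_j w j *: z (h j) == 0) = (\sum_j w j *: y (h j) == 0).
Proof.
move=> zy; rewrite -(dnorm_eq0 dot) -(dnorm_eq0 (@dotmx C s)).
congr (_ == 0); rewrite dot_sumZl [RHS]linear_sumlz; apply: eq_bigr => j _.
rewrite linearZl_LR; congr (_ * _).
rewrite dot_sumZr [RHS]linear_sumr; apply: eq_bigr => i _.
by rewrite linearZr_LR zy -dotmxE.
Qed.

(** The hypotheses say that the shift of [c] to [c + 1] is symmetric and well defined on the span of
    the vectors with [c < n]. In Gram coordinates it extends to a Hermitian matrix, and in an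
    eigenbasis it multiplies the coordinates by the eigenvalues [D]. *)
Lemma krylov_coordinates (K L : finType) n (x : K -> nat -> V) (f : L -> V) :
    (forall k k' c c', (c < n)%N -> (c' < n)%N ->
       dot (x k c) (x k' c'.+1) = dot (x k c.+1) (x k' c')) ->
    (forall w : K * 'I_n -> C, \sum_p w p *: x p.1 p.2 = 0 ->
       \sum_p w p *: x p.1 p.2.+1 = 0) ->
  exists s (D : 'I_s -> C) (X : K -> 'I_s -> C) (F : L -> 'I_s -> C),
  [/\ forall i, D i \is Num.real,
      forall k c l, (c <= n)%N ->
        dot (x k c) (f l) = \sum_i X k i * D i ^+ c * (F l i)^*,
      forall k c k' c', (c <= n)%N -> (c' <= n)%N ->
        dot (x k c) (x k' c') = \sum_i X k i * D i ^+ c * (X k' i * D i ^+ c')^*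
    & forall l l', dot (f l) (f l') = \sum_i F l i * (F l' i)^*].
Proof.
move=> symx kerx.
pose z (t : K * 'I_n.+1 + L) : V :=
  match t with inl p => x p.1 p.2 | inr l => f l end.
have [y yE] := gram_coordinates z.
pose J : finType := (K * 'I_n)%type.
(* [h0] and [h1] index the sources and the images of the shift. *)
pose h0 (p : J) : K * 'I_n.+1 + L := inl (p.1, widen_ord (leqnSn n) p.2).
pose h1 (p : J) : K * 'I_n.+1 + L := 
  inl (p.1, Ordinal (ltn_ord p.2 : (p.2.+1 < n.+1)%N)).
have zh0 p : z (h0 p) = x p.1 p.2 by [].
have zh1 p : z (h1 p) = x p.1 p.2.+1 by [].
set s := #|_| in y yE.
pose X0 := \matrix_(i < #|J|) y (h0 (enum_val i)).
pose X1 := \matrix_(i < #|J|) y (h1 (enum_val i)).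
have symX : X0 *m X1^t* = X1 *m X0^t*.
  apply/matrixP => i j.
  transitivity (dot (z (h0 (enum_val i))) (z (h1 (enum_val j)))).
    by rewrite yE !mxE; apply: eq_bigr => l _; rewrite !mxE.
  transitivity (dot (z (h1 (enum_val i))) (z (h0 (enum_val j)))).
    by rewrite !zh0 !zh1 symx.
  by rewrite yE !mxE; apply: eq_bigr => l _; rewrite !mxE.
have rowE (h : J -> K * 'I_n.+1 + L) (c : 'rV_#|J|) :
    c *m (\matrix_(i < #|J|) y (h (enum_val i))) =
    \sum_p c 0 (enum_rank p) *: y (h p).
  rewrite mulmx_sum_row (reindex enum_rank) /=; last first.
    by apply: onW_bij; apply: enum_rank_bij.
  by apply: eq_bigr => p _; rewrite rowK enum_rankK.
have kerX (c : 'rV_#|J|) : c *m X0 = 0 -> c *m X1 = 0.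
  rewrite !rowE => /eqP; rewrite -(gram_kernel _ _ yE) => /eqP /kerx x1.
  by apply/eqP; rewrite -(gram_kernel _ _ yE); apply/eqP.
have [H adjH XH] := hermitian_extension symX kerX.
have [P [D [PP HE Dreal]]] := hermitian_diagonalization adjH.
pose Y t := y t *m P^t*.
have PtP : P^t* *m P = 1%:M by apply: mulmx1C.
have YE p q : dot (z p) (z q) = \sum_i Y p 0 i * (Y q 0 i)^*.
  rewrite yE -[y p]mulmx1 -PtP !mulmxA -(mulmxA _ P) -[P]trmxCK -adjmxM trmxCK mxE.
  by apply: eq_bigr => i _; rewrite !mxE.
have YD k (c : nat) (cn : (c < n.+1)%N) i :
    Y (inl (k, Ordinal cn)) 0 i = Y (inl (k, ord0)) 0 i * D i ^+ c.
  elim: c => [|c IH] in cn *.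
    by rewrite expr0 mulr1; congr (Y (inl (_, _)) _ _); apply: val_inj.
  have cn' : (c < n)%N by [].
  have c1 : (c < n.+1)%N by apply: ltnW.
  rewrite exprSr mulrA -(IH c1).
  have y1 : y (h1 (k, Ordinal cn')) = y (h0 (k, Ordinal cn')) *m H.
    have /matrixP XHE := XH; apply/rowP => j.
    have := XHE (enum_rank (k, Ordinal cn')) j; rewrite !mxE enum_rankK => <-.
    by apply: eq_bigr => l _; rewrite mxE enum_rankK.
  have -> : inl (k, Ordinal cn) = h1 (k, Ordinal cn').
    by congr (inl (_, _)); apply: val_inj.
  have -> : inl (k, Ordinal c1) = h0 (k, Ordinal cn').
    by congr (inl (_, _)); apply: val_inj.
  rewrite /Y y1 HE -!mulmxA PP mulmx1 !mulmxA mul_mx_diag.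
  by rewrite mxE [(\row__ _) _ _]mxE.
exists s, D, (fun k => Y (inl (k, ord0)) 0), (fun l => Y (inr l) 0); split=> //.
- move=> k c l; rewrite -ltnS => cn; have := YE (inl (k, Ordinal cn)) (inr l).
  by move=> /= ->; apply: eq_bigr => i _; rewrite YD.
- move=> k c k' c'; rewrite -(ltnS c) -(ltnS c') => cn cn'.
  have := YE (inl (k, Ordinal cn)) (inl (k', Ordinal cn')).
  by move=> /= ->; apply: eq_bigr => i _; rewrite (YD k c cn) (YD k' c' cn').
- by move=> l l'; rewrite -(YE (inr l) (inr l')).
Qed.

End Krylov.

(** In the eigenbasis [x k 0] is [(1 + D^n)^-1 e k], so powers of the shift give values of [twopt];
    the factor [\sum_j bl l j * bk k j] is absorbed by tensoring [e k] with [bk k] and [f l] with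
    [bl l]. *)
Lemma krylov_det_bound (C : numClosedFieldType) (V : lmodType C)
    (dot : {dot V for Num.conj}) (J : finType) m N (x : 'I_N -> nat -> V)
    (e f : 'I_N -> V) (bk bl : 'I_N -> J -> C) (a b : 'I_N -> nat) :
    (0 < m)%N -> (forall k, a k < m.*2)%N -> (forall l, b l < m.*2)%N ->
    (forall k k' c c', (c < m.*2)%N -> (c' < m.*2)%N ->
       dot (x k c) (x k' c'.+1) = dot (x k c.+1) (x k' c')) ->
    (forall w : 'I_N * 'I_m.*2 -> C, \sum_p w p *: x p.1 p.2 = 0 ->
       \sum_p w p *: x p.1 p.2.+1 = 0) ->
    (forall k, x k 0%N + x k m.*2 = e k) ->
  `|\det (\matrix_(k < N, l < N) ((\sum_j bl l j * bk k j) *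
      (if (a k <= b l)%N then dot (x k (m.*2 - ((b l).+1 - a k))%N) (f l)
       else - dot (x k (a k - (b l).+1)%N) (f l))))| <=
  (\prod_k sqrtC (dot (e k) (e k) * \sum_j `|bk k j| ^+ 2)) *
  \prod_l sqrtC (dot (f l) (f l) * \sum_j `|bl l j| ^+ 2).
Proof.
move=> m0 am bm symx kerx xe; set n := m.*2 in am bm symx kerx xe *.
have [s [D [X [F [DR XF XX FF]]]]] := krylov_coordinates f symx kerx.
pose u k (p : 'I_s * J) := X k p.1 * (1 + D p.1 ^+ n) * bk k p.2.
(* The entries carry the sign opposite to [twopt], whence the minus. *)
pose v l (p : 'I_s * J) := - (F l p.1)^* * bl l p.2.
have D1 i : 1 + D i ^+ n != 0.
  by rewrite gt_eqF // ltr_wpDr // /n -mul2n exprM exprn_ge0 // -realEsqr.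
have un k : \sum_p `|u k p| ^+ 2 = dot (e k) (e k) * \sum_j `|bk k j| ^+ 2.
  transitivity (\sum_i \sum_j `|X k i * (1 + D i ^+ n)| ^+ 2 * `|bk k j| ^+ 2).
    by rewrite pair_bigA; apply: eq_bigr => p _; rewrite /u normrM exprMn.
  rewrite -xe linearDl !linearDr /= !XX // -!big_split /= mulr_suml.
  apply: eq_bigr => i _; rewrite -mulr_sumr; congr (_ * _).
  by rewrite normCK !expr0 !mulr1 mulrDr mulr1 rmorphD; ring.
have vn l : \sum_p `|v l p| ^+ 2 = dot (f l) (f l) * \sum_j `|bl l j| ^+ 2.
  transitivity (\sum_i \sum_j `|F l i| ^+ 2 * `|bl l j| ^+ 2).
    rewrite pair_bigA; apply: eq_bigr => p _.
    by rewrite /v normrM normrN norm_conjC exprMn.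
  rewrite FF mulr_suml; apply: eq_bigr => i _; rewrite -mulr_sumr normCK //.
have := @twopt_det_scaled C _ (fun p : 'I_s * J => D p.1) m N a b u v
  (fun p => DR p.1) m0 am bm.
under eq_bigr do rewrite un; under [X in _ * X]eq_bigr do rewrite vn.
apply: le_trans; rewrite le_eqVlt; apply/orP; left; apply/eqP.
congr (`|\det _|); apply/matrixP => k l; rewrite !mxE -/n.
have xf c : (c <= n)%N -> dot (x k c) (f l) = \sum_i X k i * D i ^+ c * (F l i)^*.
  exact: XF.
transitivity (\sum_i \sum_j v l (i, j) * u k (i, j) * twopt n (a k) (b l) (D
  i)); last first.
  by rewrite pair_bigA; apply: eq_bigr => -[].
rewrite /twopt; case: ifP => ab.
  rewrite xf ?leq_subr // mulr_sumr; apply: eq_bigr => i _; rewrite mulr_suml;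
    apply: eq_bigr => j _.
  by rewrite /u /v /=; have := D1 i; move: (D i ^+ n) => y y0; field.
rewrite xf; last by rewrite (leq_trans (leq_subr _ _)) // ltnW.
rewrite -sumrN mulr_sumr; apply: eq_bigr => i _; rewrite mulr_suml;
  apply: eq_bigr => j _.
by rewrite /u /v /=; have := D1 i; move: (D i ^+ n) => y y0; field.
Qed.

Local Open Scope classical_set_scope.
Local Open Scope ring_scope.
Local Open Scope complex_scope.

(** * The upper bound for arbitrary self-adjoint operators *)

Section RealPsd.
Variable R : realType.

Lemma conj_realc (x : R) : Num.conj x%:C = x%:C :> R[i].
Proof. exact: conjc_real. Qed.

Lemma sqrtC_realc (x : R) : 0 <= x -> sqrtC x%:C = (Num.sqrt x)%:C :> R[i].
Proof.
move=> x0; rewrite -{1}(sqr_sqrtr x0) rmorphXn /= sqrCK //.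
by rewrite ler0c sqrtr_ge0.
Qed.

Lemma real_psd_factor m (M : 'M[R]_m) : psd M ->
  exists B : 'M[R[i]]_m, forall i j, (M i j)%:C = \sum_l B i l * Num.conj (B j l).
Proof.
move=> [symM psdM]; pose c p q (A : 'M[R]_(p, q)) : 'M[R[i]]_(p, q) :=
  map_mx (real_complex R) A.
have adjc p q (A : 'M[R]_(p, q)) : (c _ _ A)^t* = c _ _ A^T.
  by apply/matrixP => i j; rewrite !mxE conj_realc.
have [|x|B BE] := @psd_factor _ _ (c _ _ M).
- by rewrite adjc symM.
(* With [x = a + i b] the cross terms cancel by the symmetry of [M], leaving two real quadratic
   forms. *)
- pose a := \row_j complex.Re (x 0 j); pose b := \row_j complex.Im (x 0 j).
  have xE : x = c _ _ a + 'i *: c _ _ b.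
    by apply/rowP => j; rewrite !mxE -complexE.
  have cM p q r (A : 'M[R]_(p, q)) (D : 'M[R]_(q, r)) :
      c _ _ A *m c _ _ D = c _ _ (A *m D) by rewrite /c map_mxM.
  have psd_row (w : 'rV[R]_m) : 0 <= (w *m M *m w^T) 0 0.
    by have := psdM w^T; rewrite trmxK.
  have ab : (a *m M *m b^T) 0 0 = (b *m M *m a^T) 0 0.
    transitivity ((a *m M *m b^T)^T 0 0); first by rewrite [RHS]mxE.
    by rewrite !trmx_mul trmxK symM mulmxA.
  rewrite (_ : (x *m _ *m _) 0 0 =
      ((a *m M *m a^T) 0 0 + (b *m M *m b^T) 0 0)%:C) ?ler0c ?addr_ge0 //.
  rewrite xE adjmxD !adjc [('i *: _)^t*](_ : _ = - ('i : R[i]) *: c _ _ b^T);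
    last first.
    by rewrite -adjc linearZ /= map_mxZ /=; congr (_ *: _); apply/eqP;
      rewrite eq_complex /= oppr0 !eqxx.
  rewrite !(mulmxDl, mulmxDr) -!(scalemxAl, scalemxAr) !cM.
  move: (a *m M *m a^T) (b *m M *m b^T) (a *m M *m b^T) (b *m M *m a^T) ab =>
    A1 A2 A3 A4 ab.
  rewrite !mxE ab.
  by rewrite rmorphD /= !mulNr mulrN mulrA -expr2 sqr_i mulN1r opprK addrA addrK.
exists B => i j; have /matrixP/(_ i j) := BE; rewrite !mxE => ->.
by apply: eq_bigr => l _; rewrite !mxE.
Qed.

End RealPsd.

(** Here [K] is everywhere defined and [<z, K z>] is the total mass [<z, z>] of [mu z]; polarization
    then identifies [K] with the identity. *)
Lemma spectral_calculus_cst1 (R : realType) (E : lmodType R[i]) (ip : E -> E ->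
  R[i])
    (A K : set (E * E)) (x y : E) :
    (forall z, scalar (ip z)) -> (forall z w, ip z w = Num.conj (ip w z)) ->
    (forall z, 0 <= ip z z) -> (forall z, ip z z = 0 -> z = 0) ->
    spectral_calculus ip A (cst 1) K -> K (x, y) -> y = x.
Proof.
move=> ipl ipC ip_ge0 ip_eq0 [P [mu [[_ PT muE] _ [[K0 KD Kfun] Kdom KE]]]].
have muT z : mu z setT = (complex.Re (ip z z))%:E by rewrite muE ?PT.
have int1 z : (\int[mu z]_(t in setT) (1 : R)%:E)%E = (complex.Re (ip z z))%:E.
  by rewrite integral_cst // muT mul1e.
have Kip z w : K (z, w) -> ip z w = ip z z.
  move=> /KE ->; rewrite /Rintegral int1 /=.
  by rewrite RRe_real // ger0_real.
have domK z : exists w, K (z, w).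
  suff : op_dom K z by [].
  rewrite Kdom /=; under eq_integral do rewrite expr1n.
  by rewrite int1 ltry.
have ipDr z u v : ip z (u + v) = ip z u + ip z v.
  by have := ipl z 1 u v; rewrite scale1r mul1r.
have ipZr z a u : ip z (a *: u) = a * ip z u.
  have ip0 : ip z 0 = 0 by have := ipDr z 0 0; rewrite addr0 => /eqP;
    rewrite eq_sym -subr_eq0 addrK => /eqP.
  by have := ipl z a u 0; rewrite !addr0 ip0 addr0.
have ipDl z u v : ip (u + v) z = ip u z + ip v z.
  by rewrite ipC ipDr rmorphD /= -!ipC.
have ipZl z a u : ip (a *: u) z = Num.conj a * ip u z.
  by rewrite ipC ipZr rmorphM /= -ipC.
move=> Kxy; have [z zE] : exists z, z = y - x by exists (y - x).
have [w Kzw] := domK z.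
have zw := Kip _ _ Kzw; have xy := Kip _ _ Kxy.
(* The quadratic form of [K] at [c z + x]; the values [c = 1] and [c = i] together force
   [<z, z> = 0]. *)
have key (c : R[i]) : Num.conj c * ip z z + c * (ip x w - ip x z) = 0.
  have := Kip _ _ (KD c _ _ _ _ Kzw Kxy).
  rewrite !(ipDl, ipDr, ipZl, ipZr) zw xy.
  have -> : ip z y = ip z z + ip z x by rewrite -ipDr zE subrK.
  move/eqP; rewrite -subr_eq0 => /eqP <-; ring.
have h1 := key 1; have hi := key 'i.
rewrite conjC1 !mul1r in h1.
have conji : Num.conj ('i : R[i]) = - 'i by apply/eqP;
  rewrite eq_complex /= oppr0 !eqxx.
rewrite conji mulNr addrC -mulrBr in hi.
have i0 : ('i : R[i]) != 0 by rewrite eq_complex /= oner_eq0 andbF.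
have {hi} hi : ip x w - ip x z = ip z z.
  by apply/eqP; rewrite -subr_eq0; move/eqP: hi; rewrite mulf_eq0 (negbTE i0).
move/eqP: h1; rewrite hi -mulr2n mulrn_eq0 /= => /eqP /ip_eq0 /eqP; rewrite zE.
by rewrite subr_eq0 => /eqP.
Qed.

Lemma val_torus_nat n k : (k < n.*2)%N -> (k%:R : 'Z_(n.*2)) = k :> nat.
Proof. by move=> kn; rewrite val_Zp_nat ?modn_small //; lia. Qed.

Lemma torus_pt_lt (R : realType) (beta : R) n (a : 'Z_(n.*2)) :
  0 < beta -> (0 < n)%N -> 0 <= torus_pt beta a < beta -> (a < n)%N.
Proof.
move=> beta_gt0 n_gt0.
have nR : 0 < n%:R :> R by rewrite ltr0n.
have t0 : 0 < beta / n%:R by rewrite divr_gt0.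
have an : (a < n.*2)%N by rewrite -[X in (_ < X)%N](@Zp_cast n.*2) ?ltn_ord //; lia.
rewrite /torus_pt; case: ifP => na /andP[h0 h1].
  by move: h1; rewrite mulrCA gtr_pMr // ltr_pdivrMr // mul1r ltr_nat.
move: h0; rewrite pmulr_lge0 // subr_ge0 ler_nat; lia.
Qed.

(** Written as a successor to match the values [F (c.+1)%:R] in [covariance_chain]. *)
Lemma torus_subr n (a b : 'Z_(n.*2)) : (b < a)%N ->
  a - b = ((a - b.+1).+1)%:R :> 'Z_(n.*2).
Proof.
by move=> ba; rewrite -subSn // subSS natrB ?(ltnW ba) // !natr_Zp.
Qed.

(** A shift by the half period brings a nonpositive difference back to the points 1 to [n], at the
    cost of the antiperiodic sign. *)
Lemma torus_subrn n (a b : 'Z_(n.*2)) : (a <= b)%N -> (b < n)%N ->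
  a - b + n%:R = ((n - (b.+1 - a)).+1)%:R :> 'Z_(n.*2).
Proof.
move=> ab bn; have -> : ((n - (b.+1 - a)).+1 = n - (b - a))%N by lia.
by rewrite natrB ?natrB ?natr_Zp //; [ring | lia].
Qed.

Section L2ap.
Variables (R : realType) (V : lmodType R[i]) (n : nat).
Implicit Types f g : l2ap V n.

Lemma l2apP c f g a : (c *: f + g) a = c *: f a + g a.
Proof. by rewrite !ffunE. Qed.

Lemma l2apZ c f a : (c *: f) a = c *: f a.
Proof. by rewrite !ffunE. Qed.

Lemma l2apN f a : f (a + n%:R) = - f a.
Proof. by have /forallP/(_ a)/eqP := l2ap_valP f. Qed.

Lemma l2ap_inj f g : (forall a, f a = g a) -> f = g.
Proof. by move=> fg; apply/val_inj/ffunP. Qed.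

End L2ap.

Section UpperBound.
Variables (R : realType) (V : completeNormedModType R[i]).
Variable dot : {dot V for Num.conj}.
Variables (beta : R) (n : nat).
Hypotheses (beta_gt0 : 0 < beta) (n_gt0 : (0 < n)%N).

Let t0 : 0 < beta / n%:R.
Proof. by rewrite divr_gt0 // ltr0n. Qed.

Lemma l2ap_ip_scalar (f : l2ap V n) : scalar (l2ap_ip beta (braket dot) f).
Proof.
move=> c x y; rewrite /l2ap_ip mulrCA -mulrDr; congr (_ * _).
rewrite /braket mulr_sumr -big_split /=; apply: eq_bigr => a _.
by rewrite l2apP linearDl linearZl_LR.
Qed.

Lemma l2ap_ipC (f g : l2ap V n) :
  l2ap_ip beta (braket dot) f g = Num.conj (l2ap_ip beta (braket dot) g f).
Proof.
rewrite /l2ap_ip; move: (beta / n%:R) => s.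
rewrite rmorphM /= conj_realc rmorph_sum; congr (_ * _).
by apply: eq_bigr => a _; rewrite /braket dotC.
Qed.

Lemma l2ap_ip_ge0 (f : l2ap V n) : 0 <= l2ap_ip beta (braket dot) f f.
Proof.
rewrite /l2ap_ip mulr_ge0 //; first by rewrite ler0c ltW.
by apply: sumr_ge0 => a _; apply: dnorm_ge0.
Qed.

Lemma spectral_calculus_l2ap_cst1 (A K : set (l2ap V n * l2ap V n)) (f g : l2ap
  V n) :
  spectral_calculus (l2ap_ip beta (braket dot)) A (cst 1) K -> K (f, g) -> g = f.
Proof.
apply: (spectral_calculus_cst1 l2ap_ip_scalar l2ap_ipC l2ap_ip_ge0).
move=> z /eqP; rewrite /l2ap_ip mulf_eq0 => /orP[|].
  by rewrite eq_complex /= gt_eqF.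
rewrite psumr_eq0 => [/allP z0|a _]; last exact: dnorm_ge0.
apply: l2ap_inj => a; rewrite [RHS]ffunE; apply/eqP; rewrite -(dnorm_eq0 dot).
by apply: z0; rewrite mem_index_enum.
Qed.

(** With [F = -2 y] and [t = beta / n], the equation for [y] is [y(a+1) = y(a) + t (hat_vec e (a) -
    H y(a))], so that [x c = 2 y(c+1)] is iterated by [1 - t H] away from the origin. Crossing the
    origin with [y(n) = - y(0)] and [2 t delta_ap(0) = 1] yields the last identity. *)
Lemma covariance_chain (H : set (V * V)) (e : V) (F : l2ap V n) :
    linear_operator H -> Defs.covariance beta H (hat_vec beta n e, F) ->
  exists x g : nat -> V,
  [/\ forall c, (c < n)%N -> H (x c, g c),
      forall c, (c < n)%N -> x c.+1 = x c - (beta / n%:R)%:C *: g c,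
      forall c, (c < n)%N -> F (c.+1)%:R = - x c
    & x 0%N + x n = e].
Proof.
move=> [H0 HD _] [y [p [q [/= py hq pq]]] FE].
have nn2 : (n < n.*2)%N by lia.
have nC : (n%:R : R[i]) != 0 by rewrite pnatr_eq0 -lt0n.
have bC : beta%:C != 0 :> R[i] by rewrite eq_complex /= gt_eqF.
have tE : (beta / n%:R)%:C = beta%:C / n%:R :> R[i].
  by rewrite rmorphM fmorphV /= rmorph_nat.
set t := (beta / n%:R)%:C in tE *.
have step a : y (a + 1) = y a + t *: (hat_vec beta n e a - q a).
  rewrite pq ffunE addrK py scalerA (_ : t * _ = 1) ?scale1r ?subrKC //.
  by rewrite tE rmorphM fmorphV /= rmorph_nat mulrC mulrA divfK // divff.
have FyE a : F a = - (2 *: y a).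
  by rewrite FE l2apZ scaleNr.
(* The value at [n] is the one that the recursion demands; it differs from [2 y(n+1) = - 2 y(1)] by
   the source [e]. *)
pose x c := if (c < n)%N then 2 *: y (c.+1)%:R else e - 2 *: y 1.
exists x, (fun c => 2 *: q (c.+1)%:R); split.
- move=> c cn; rewrite /x cn.
  by have := HD 2 _ _ _ _ (hq (c.+1)%:R) H0; rewrite !addr0.
- move=> c cn; rewrite /x cn; case: ifP => [c1n|c1n].
    rewrite -(natr1 c.+1) step hat_vecE // /delta_ap.
    rewrite -!val_eqE /= !val_torus_nat; try lia.
    rewrite ifF; last lia.
    rewrite scale0r sub0r scalerN scalerBr !scalerA; congr (_ - _ *: _);
      exact: mulrC.
  have -> : c.+1 = n by lia.
  have := step 0; rewrite add0r => ->; rewrite hat_vecE // /delta_ap eqxx.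
  have yn : y n%:R = - y 0 by rewrite -l2apN add0r.
  have qn : q n%:R = - q 0 by rewrite -l2apN add0r.
  rewrite yn qn.
  have t2 : 2 * t * (n%:R / (2 * beta))%:C = 1.
    rewrite tE rmorphM fmorphV rmorphM /= !rmorph_nat.
    by field; rewrite bC nC.
  rewrite scalerDr !scalerBr !scalerA t2 scale1r opprD opprB addrCA addrA addrC.
  by rewrite addrACA addNr addr0 !scalerN opprK [t * 2]mulrC addrC.
- by move=> c cn; rewrite FyE /x cn.
- by rewrite /x n_gt0 ltnn addrCA subrr addr0.
Qed.

End UpperBound.

Section UpperBoundGlue.
Variables (R : realType) (V : completeNormedModType R[i]).
Variables (dot : {dot V for Num.conj}) (H : set (V * V)).

Lemma self_adjoint_dot : self_adjoint dot H ->
  forall x y x' y', H (x, y) -> H (x', y') -> dot x y' = dot y x'.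
Proof.
move=> [_ _ HE] x y x' y' Hxy Hxy'.
move: Hxy'; rewrite HE => /(_ _ _ Hxy); rewrite /braket /= => yx.
by rewrite yx.
Qed.

Lemma linear_operator_sum (T : finType) (w : T -> R[i]) (x y : T -> V) :
  linear_operator H -> (forall p, H (x p, y p)) ->
  H (\sum_p w p *: x p, \sum_p w p *: y p).
Proof.
move=> [H0 HD _] Hxy; elim/big_rec2: _ => // p u v _ Huv; exact: HD.
Qed.

Lemma determinant_bound1 (I : countType) (phi : I -> V) :
  orthonormal_basis dot phi -> self_adjoint dot H ->
  determinant_bound dot phi H (cst 1) 1.
Proof.
move=> [phi1 _] saH; have [linH _ _] := saH.
split; [exact: measurable_cst | by move=> t; exact: ler01 | exact: ltr01 |].
move=> beta n K beta0 n0 nev SC m N M m0 N0 psdM alpha i j alphaP.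
rewrite expr1n mul1r.
pose e k := phi (i (lshift N k)); pose f l := phi (i (rshift N l)).
pose F k := op_app (op_comp (Defs.covariance beta H) K) (hat_vec beta n (e k)).
(* [op_app] takes the value 0 outside the domain; the determinant then has a zero row and the bound
   is trivial. *)
have FP k : Defs.covariance beta H (hat_vec beta n (e k), F k) \/ F k = 0.
  rewrite /F /op_app; case: xgetP => [y _ [z /= Kz cz]|_]; [left|by right].
  by rewrite -(spectral_calculus_l2ap_cst1 beta0 n0 SC Kz).
have [B BE] := real_psd_factor psdM.
have sqrM q : sqrtC (\sum_l `|B q l| ^+ 2) = (Num.sqrt (M q q))%:C.
  under eq_bigr do rewrite normCK.
  rewrite -BE sqrtC_realc // -ler0c BE; apply: sumr_ge0 => l _.
  by rewrite -normCK exprn_ge0.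
have [covF|] := pselect (forall k, Defs.covariance beta H (hat_vec beta n (e
  k), F k)); last first.
  move=> /existsNP[k ncov]; have Fk0 : F k = 0 by case: (FP k).
  rewrite (expand_det_row _ k) big1 ?normr0 => [|l _].
    by rewrite ler0c; apply: prodr_ge0 => q _; exact: sqrtr_ge0.
  by rewrite mxE -/(F k) Fk0 ffunE /braket linear0l mulr0 mul0r.
have /choice[x /choice[g xg]] := fun k => covariance_chain beta0 n0 linH (covF k).
have Hx k c : (c < n)%N -> H (x k c, g k c).
  by case: (xg k) => + _ _ _; apply.
have xS k c : (c < n)%N -> x k c.+1 = x k c - (beta / n%:R)%:C *: g k c.
  by case: (xg k) => _ + _ _; apply.
have Fx k c : (c < n)%N -> F k (c.+1)%:R = - x k c.
  by case: (xg k) => _ _ + _; apply.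
have xe k : x k 0%N + x k n = e k by case: (xg k).
pose a k := nat_of_ord (alpha (lshift N k));
  pose b l := nat_of_ord (alpha (rshift N l)).
have an k : (a k < n)%N by exact: torus_pt_lt beta0 n0 (alphaP _).
have bn l : (b l < n)%N by exact: torus_pt_lt beta0 n0 (alphaP _).
have nE : n = n./2.*2 by rewrite even_halfK.
have half0 : (0 < n./2)%N by lia.
have := @krylov_det_bound _ V dot 'I_m n./2 N x e f (fun k => B (j (lshift N k)))
  (fun l p => Num.conj (B (j (rshift N l)) p)) a b half0.
rewrite -nE => /(_ an bn).
set A := \matrix_(k, l) _; set A' := \matrix_(k, l) _.
have -> : A' = A.
  apply/matrixP => k l; rewrite !mxE BE; congr (_ * _).
    by apply: eq_bigr => p _; rewrite mulrC.
  rewrite -/(F k) /braket; case: ifP => ab.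
    have ab' : (n - ((b l).+1 - a k) < n)%N by lia.
    have -> : F k (alpha (lshift N k) - alpha (rshift N l)) = x k (n - ((b
      l).+1 - a k))%N.
      apply: oppr_inj; rewrite -Fx // -l2apN; congr (F k _).
      exact: torus_subrn (bn l).
    by [].
  have ab' : (b l < a k)%N by lia.
  rewrite torus_subr // Fx ?linearNl //.
  exact: leq_ltn_trans (leq_subr _ _) (an k).
move=> le_det; apply: le_trans (le_det _ _ xe) _.
(* The symmetry of [H] passes to [1 - t H]. *)
- move=> k k' c c' cn cn'; rewrite !xS // linearBr linearBl /=.
  rewrite linearZr_LR linearZl_LR /= conj_realc.
  by rewrite (self_adjoint_dot saH (Hx k c cn) (Hx k' c' cn')).
(* A linear relation among the arguments also holds among their images, [H] being linear and
   single-valued. *)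
- move=> w w0; under eq_bigr do rewrite xS // scalerBr scalerA mulrC -scalerA.
  rewrite big_split /= w0 add0r sumrN -scaler_sumr.
  have := linear_operator_sum w linH (fun p => Hx p.1 p.2 (ltn_ord p.2)).
  rewrite w0; case: linH => _ _ funH /funH ->; first by rewrite scaler0 oppr0.
- rewrite big_split_ord /= rmorphM !rmorph_prod /=.
  have dot1 p : dot (phi p) (phi p) = 1 by have := phi1 p p; rewrite eqxx.
  rewrite le_eqVlt; apply/orP; left; apply/eqP; congr (_ * _).
    by apply: eq_bigr => k _; rewrite dot1 mul1r sqrM.
  apply: eq_bigr => l _; rewrite dot1 mul1r -sqrM; congr sqrtC.
  by apply: eq_bigr => p _; rewrite norm_conjC.
Qed.

End UpperBoundGlue.

(** * The complex line as a Hilbert space, and multiples of the identity *)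

Section ComplexLine.
Variable R : realType.

Lemma complex_norm_le (z : R[i]) :
  `|z| <= (`|complex.Re z| + `|complex.Im z|)%:C.
Proof.
have normR (x : R) : `|x%:C| = `|x|%:C :> R[i].
  by rewrite normc_def /= expr0n addr0 sqrtr_sqr.
rewrite {1}[z]complexE rmorphD; apply: le_trans (ler_normD _ _) _ => /=.
by rewrite normrM !normR normc_def /= expr0n expr1n add0r sqrtr1 mul1r.
Qed.

Lemma normc_ge_Im (z : R[i]) : `|complex.Im z|%:C <= `|z|.
Proof.
rewrite normc_def lecR -sqrtr_sqr ler_wsqrtr // lerDr; exact: sqr_ge0.
Qed.

Lemma complex_complete (F : set_system R[i]^o) : ProperFilter F -> cauchy F ->
  cvg F.
Proof.
move=> FF /cauchy_ballP Fc.
have proj_cauchy (p : R[i] -> R) : (forall z w : R[i], `|p z - p w|%:C <= `|z -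
  w|) ->
    cauchy (p @ F).
  move=> p_le; apply/cauchy_ballP => e e0.
  have /Fc : (0 : R[i]) < e%:C by rewrite ltcR.
  case=> -[A B] /= [FA FB] AB.
  exists (p @` A, p @` B) => /=; first split.
  - by apply: filterS FA => z Az; exists z.
  - by apply: filterS FB => z Bz; exists z.
  move=> [_ _] [/= [z Az <-] [w Bw <-]].
  have := AB (z, w) (conj Az Bw); rewrite /ball /= => zw.
  by rewrite -ltcR; apply: le_lt_trans zw.
have reE : cvg (@complex.Re R @ F).
  apply: cauchy_cvg; apply: proj_cauchy => z w.
  by rewrite -raddfB; exact: normc_ge_Re.
have imE : cvg (@complex.Im R @ F).
  apply: cauchy_cvg; apply: proj_cauchy => z w.
  by rewrite -raddfB; exact: normc_ge_Im.
apply/cvg_ex; exists (Complex (lim (@complex.Re R @ F)) (lim (@complex.Im R @ F))).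
apply/cvgrPdist_lt => e e0.
have eE : e = (complex.Re e)%:C by rewrite RRe_real // ger0_real // ltW.
have e2 : 0 < complex.Re e / 2 by rewrite divr_gt0 // -ltcR -eE.
have /cvgrPdist_lt/(_ _ e2) reF := reE; have /cvgrPdist_lt/(_ _ e2) imF := imE.
near=> z; apply: le_lt_trans (complex_norm_le _) _.
rewrite eE ltcR [ltRHS]splitr; apply: ltrD.
  by rewrite raddfB /=; near: z; exact: reF.
by rewrite raddfB /=; near: z; exact: imF.
Unshelve. all: by end_near. Qed.

(* An alias of [R[i]^o]: the canonical complete structure of [K^o] is reserved
   for a [realType] [K]. *)
Definition complex_line : Type := R[i]^o.

HB.instance Definition _ := NormedModule.copy complex_line R[i]^o.
HB.instance Definition _ := Uniform_isComplete.Build complex_line complex_complete.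

Definition cdot (x y : complex_line) : R[i] := x * Num.conj (y : R[i]).

Lemma cdot_bilinear : bilinear_for
  (GRing.Scale.Law.clone _ _ ( *%R ) _) (GRing.Scale.Law.clone _ _ (Num.conj \;
    *%R ) _) cdot.
Proof.
split=> [y a u v|x a u v]; rewrite /cdot.
  by rewrite mulrDl -mulrA.
by rewrite rmorphD rmorphM /= mulrDr mulrCA.
Qed.

HB.instance Definition _ := bilinear_isBilinear.Build R[i] _ _ _ _ _ cdot
  cdot_bilinear.

Lemma cdot_hermitian (x y : complex_line) : cdot x y = (-1) ^+ false * Num.conj
  (cdot y x).
Proof. by rewrite mul1r /cdot rmorphM /= [RHS]mulrC; congr (_ * _);
  rewrite [RHS]conjCK. Qed.

HB.instance Definition _ := @isHermitianSesquilinear.Build R[i] complex_line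
  false Num.conj cdot cdot_hermitian.

Lemma cdot_gt0 (x : complex_line) : x != 0 -> 0 < cdot x x.
Proof. by move=> x0; rewrite /cdot -normCK exprn_gt0 // normr_gt0. Qed.

HB.instance Definition _ := @isDotProduct.Build R[i] complex_line cdot cdot_gt0.

End ComplexLine.

Definition scalar_op (R : realType) (E : lmodType R[i]) (c : R) : set (E * E) :=
  [set p | p.2 = c%:C *: p.1].

Lemma scalar_op_linear (R : realType) (E : lmodType R[i]) (c : R) :
  linear_operator (@scalar_op R E c).
Proof.
rewrite /scalar_op; split=> [|a x y x' y' /= -> ->|y /= ->]; rewrite /= ?scaler0 //.
by rewrite scalerDr !scalerA mulrC.
Qed.

Lemma Rintegral_mscale_dirac (R : realType) (k : {nonneg R}) (c : R)
    (f : R -> R) : measurable_fun [set: R] f ->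
  (\int[mscale k (dirac (c : measurableTypeR R))]_(t in setT) (f t)%:E =
   (k%:num * f c)%R%:E)%E.
Proof.
move=> mf; have mf' : measurable_fun setT (EFin \o f) by exact/measurable_EFinP.
have mp := measurable_funepos mf'; have mn := measurable_funeneg mf'.
rewrite integralE !ge0_integral_mscale // !integral_dirac //.
rewrite !diracT !mul1e -muleBr ?add_def_funeposneg //.
rewrite -[X in (_ * X)%E]/((fun x => _ - _)%E c) -funeposneg EFinM; exact: erefl.
Qed.

(** The spectral measure is the Dirac mass at [c]: [P B] is the identity or 0 according to whether
    [c] lies in [B], and [mu x] is the Dirac measure scaled by [<x, x>]. *)
Lemma spectral_calculus_scalar (R : realType) (E : lmodType R[i]) (ip : E -> E
  -> R[i])
    (c : R) (f : R -> R) :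
    (forall z, scalar (ip z)) -> (forall z w, ip z w = Num.conj (ip w z)) ->
    (forall z, 0 <= ip z z) -> measurable_fun [set: R] f ->
  spectral_calculus ip (scalar_op c) f (scalar_op (f c)).
Proof.
move=> ipl ipC ip_ge0 mf.
have ipZr z a u : ip z (a *: u) = a * ip z u.
  have ip0 : ip z 0 = 0.
    by have := ipl z 1 0 0; rewrite scaler0 addr0 mul1r => /eqP;
      rewrite eq_sym -subr_eq0 addrK => /eqP.
  by have := ipl z a u 0; rewrite !addr0 ip0 addr0.
have Re_ge0 x : 0 <= complex.Re (ip x x) by rewrite -ler0c RRe_real // ger0_real.
have ipE x : (complex.Re (ip x x))%:C = ip x x by rewrite RRe_real // ger0_real.
pose P (B : set R) (x : E) := if c \in B then x else 0.
pose mu x := mscale (NngNum (Re_ge0 x)) (dirac (c : measurableTypeR R)).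
have integral_mu (g : R -> R) : measurable_fun [set: R] g ->
    spectral_integral ip mu g (scalar_op (g c)).
  move=> mg; split; first exact: scalar_op_linear.
    apply/seteqP; split=> [x _|x _] /=; last by exists ((g c)%:C *: x).
    rewrite (Rintegral_mscale_dirac _ _ (f := fun t => g t ^+ 2)) ?ltry //.
    exact: measurable_funX.
  move=> x y yE; have {yE}-> : y = (g c)%:C *: x := yE;
    rewrite ipZr /Rintegral Rintegral_mscale_dirac //=.
  by rewrite rmorphM /= ipE mulrC.
exists P, mu; split; [split| exact: integral_mu| exact: integral_mu].
- move=> B _; rewrite /P; case: (c \in B); split=> [a u v|x|x y] //=.
    by rewrite scaler0 addr0.
  have ip0 z : ip z 0 = 0 by rewrite -(scale0r (0 : E)) ipZr mul0r.
  by rewrite ip0 ipC ip0 conjC0.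
- by move=> x; rewrite /P in_setT.
- move=> x B _.
  transitivity ((complex.Re (ip x x))%:E * dirac (c : measurableTypeR R) B)%E.
    by [].
  rewrite diracE /P; case: (c \in B) => /=.
    by rewrite mule1.
  have ip0 : ip x 0 = 0 by rewrite -(scale0r (0 : E)) ipZr mul0r.
  by rewrite ip0 mule0.
Qed.

(** * Antiperiodic functions prescribed on half a period *)

Lemma torus_cases n (a : 'Z_(n.*2)) : (0 < n)%N ->
  exists2 c, (c < n)%N & a = c%:R \/ a = c%:R + n%:R.
Proof.
move=> n0; have an : (a < n.*2)%N.
  by rewrite -[X in (_ < X)%N](@Zp_cast n.*2) ?ltn_ord //; lia.
have [lt_an|le_na] := ltnP a n; first by exists a => //; left; rewrite natr_Zp.
exists (a - n)%N; first by lia.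
by right; rewrite -natrD subnK // natr_Zp.
Qed.

Section AntiperiodicExtension.
Variables (R : realType) (V : lmodType R[i]) (n : nat) (s : nat -> V).
Hypothesis n0 : (0 < n)%N.

Let ext : {ffun 'Z_(n.*2) -> V} :=
  [ffun a : 'Z_(n.*2) => if (a < n)%N then s a else - s (a - n)%N].

Fact ap_ext_antiperiodic : ext \in @antiperiodic R V n.
Proof.
have extE c : (c < n.*2)%N -> ext c%:R = if (c < n)%N then s c else - s (c - n)%N.
  by move=> cn; rewrite ffunE val_torus_nat.
apply/forallP => a; have [c cn [->|->]] := torus_cases a n0; apply/eqP.
  by rewrite -natrD !extE ?cn; [rewrite ltnNge leq_addl addnK | lia | lia].
rewrite -addrA -!natrD addnn natrD pchar_Zp ?addr0; last lia.
by rewrite !extE ?cn; [rewrite ltnNge leq_addl addnK opprK | lia | lia].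
Qed.

Definition ap_ext : l2ap V n := L2ap ap_ext_antiperiodic.

Lemma ap_extE c : (c < n)%N -> ap_ext c%:R = s c.
Proof. by move=> cn; rewrite ffunE val_torus_nat ?cn //; lia. Qed.

End AntiperiodicExtension.

(** * The lower bound, from [H = -1] on the complex line *)

Section LowerBound.
Variables (R : realType) (n : nat) (e : R).
Hypotheses (n_gt1 : (1 < n)%N) (evn : ~~ odd n) (e_gt0 : 0 < e).
Local Notation V := (complex_line R).
Local Notation H := (@scalar_op R V (-1)).
Local Notation beta := (n%:R * e).
Local Notation r := (1 + e).

Let n0 : (0 < n)%N := ltnW n_gt1.
Let betaE : beta / n%:R = e.
Proof. by rewrite mulrC mulKf // pnatr_eq0 -lt0n. Qed.
Let beta0 : 0 < beta.
Proof. by rewrite mulr_gt0 // ltr0n. Qed.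
Let r0 : 0 < r.
Proof. by rewrite addr_gt0. Qed.
Let Z0 : 1 + r ^+ n != 0.
Proof. by rewrite gt_eqF // addr_gt0 // exprn_gt0. Qed.

Lemma hat_scalar_op (c : R) : hat_op (@scalar_op R V c) = @scalar_op R (l2ap V n) c.
Proof.
apply/seteqP; split=> -[f g] fg; last first.
  by move=> a; have -> : g = c%:C *: f := fg; rewrite /scalar_op /= l2apZ.
by apply: l2ap_inj => a; rewrite l2apZ; exact: fg.
Qed.

Let w (c : nat) : R := r ^+ c.-1 / (1 + r ^+ n) / 2.

(** The solution [y] of [(partial - 1) y = hat 1] grows by the factor [r] per step from time 1 to
    [n]; its value at 0 is [- w n] by antiperiodicity and is given apart, since [0.-1 = 0]. *)
Let Y : l2ap V n :=
  ap_ext (fun c => if c is 0%N then - (w n)%:C else (w c)%:C : V) n0.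

Let YS c : (c < n)%N -> Y (c%:R + 1) = (w c.+1)%:C.
Proof.
move=> cn; rewrite natr1; have [c1n|nc1] := ltnP c.+1 n; first by rewrite ap_extE.
have -> : c.+1 = n by lia.
by rewrite -[n%:R]add0r l2apN (ap_extE _ n0 (c := 0)) //= opprK.
Qed.

(** A value of the covariance is exhibited so that [op_app] is known not to fall back on its default
    0. *)
Lemma scalar_covariance :
  exists F : l2ap V n, Defs.covariance beta H (hat_vec beta n ((1 : R[i]) : V), F).
Proof.
pose h := hat_vec beta n ((1 : R[i]) : V).
exists (- 2 *: Y), Y => //; exists (h - (-1)%:C *: Y), ((-1)%:C *: Y); split=> /=.
- have eq0 c : (c < n)%N -> (h - (-1)%:C *: Y) c%:R =
      (n%:R / beta)%:C *: (Y (c%:R + 1) - Y c%:R).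
    move=> cn; rewrite YS // ap_extE //.
    have -> : (h - (-1)%:C *: Y) c%:R = (delta_ap beta (c%:R : 'Z_(n.*2)))%:C
      *: ((1 : R[i]) : V)
        + (if c is 0%N then - (w n)%:C else (w c)%:C : V).
      rewrite -scaleNr addrC l2apP addrC hat_vecE // ap_extE //.
      by rewrite rmorphN1 opprK scale1r.
    pose sR (k : nat) : R := if k is 0%N then - w n else w k.
    have -> : (if c is 0%N then - (w n)%:C else (w c)%:C : V) = (sR c)%:C :> R[i].
      by case: (c) => //=; rewrite rmorphN.
    have key : delta_ap beta (c%:R : 'Z_(n.*2)) + sR c = n%:R / beta * (w c.+1
      - sR c).
      have nR : n%:R != 0 :> R by rewrite pnatr_eq0 -lt0n.
      rewrite /delta_ap /sR /w; case: c cn => [|c] cn /=.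
        have rn : r ^+ n = r * r ^+ n.-1 by rewrite -exprS prednK.
        have := Z0; rewrite rn expr0; move: (r ^+ n.-1) => q q0; field.
        by rewrite q0 nR gt_eqF.
      rewrite -!val_eqE /= !val_torus_nat; try lia.
      rewrite ifF; last lia.
      rewrite exprS; move: (r ^+ c) => q; have := Z0; move: (r ^+ n) => z z0; field.
      by rewrite z0 nR gt_eqF.
    rewrite -[LHS]/((delta_ap beta (c%:R : 'Z_(n.*2)))%:C * 1 + (sR c)%:C : R[i]).
    rewrite -[RHS]/((n%:R / beta)%:C * ((w c.+1)%:C - (sR c)%:C) : R[i]).
    by rewrite mulr1 -rmorphD key rmorphM rmorphB.
  move=> a; have [c cn [->|->]] := torus_cases a n0; first exact: eq0.
  have -> : c%:R + n%:R + 1 = c%:R + 1 + n%:R :> 'Z_(n.*2) by rewrite addrAC.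
  by rewrite !l2apN eq0 // -scalerN opprB opprK addrC.
- by rewrite -[hat_op _]/(hat_op H) hat_scalar_op.
- by rewrite subrK.
Qed.

(** The case [N = 1], [M = 1] with all times 0: the entry is [F 0 = x (n - 1)] in the notation of
    [covariance_chain]. *)
Lemma scalar_determinant_bound (gamma : R) :
  determinant_bound (@cdot R) (fun _ : unit => ((1 : R[i]) : V)) H (cst 1) gamma ->
  r ^+ n.-1 / (1 + r ^+ n) <= gamma ^+ 2.
Proof.
move=> [_ _ gamma0 bound]; pose K := @scalar_op R (l2ap V n) 1.
have SC : spectral_calculus (l2ap_ip beta (braket (@cdot R))) (hat_op H) (cst 1) K.
  rewrite hat_scalar_op; apply: (@spectral_calculus_scalar R _ _ (-1) (cst 1)).
  - exact: l2ap_ip_scalar.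
  - exact: l2ap_ipC.
  - exact: l2ap_ip_ge0.
  - exact: measurable_cst.
have psd1 : psd (1%:M : 'M[R]_1).
  split=> [|v]; first by rewrite trmx1.
  by rewrite mulmx1 mxE big_ord1 !mxE -expr2 sqr_ge0.
have zero_pt : 0 <= torus_pt beta (0 : 'Z_(n.*2)) < beta.
  by rewrite /torus_pt leq0n mul0r lexx beta0.
have := bound _ n K beta0 n0 evn SC 1%N 1%N 1%:M isT isT psd1 (fun=> 0) (fun=> tt)
  (fun=> 0) (fun=> zero_pt).
rewrite det_mx11 !mxE /= subrr mul1r.
set F := op_app _ _.
have covF : Defs.covariance beta H (hat_vec beta n ((1 : R[i]) : V), F).
  have [F1 covF1] := scalar_covariance.
  have : exists G, op_comp (Defs.covariance beta H) K (hat_vec beta n ((1 :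
    R[i]) : V), G).
    by exists F1, (hat_vec beta n ((1 : R[i]) : V)) => //;
      rewrite /K /scalar_op /= scale1r.
  move=> /(xgetPex 0)[z zE]; rewrite -/(op_app _ _) -/F.
  by have -> : z = hat_vec beta n ((1 : R[i]) : V) by rewrite (zE : z = _ *: _)
    scale1r.
(* These equations determine [F 0], whichever value [op_app] picks. *)
have [x [g [Hxg xS Fx x1]]] := covariance_chain beta0 n0 (@scalar_op_linear R V
  (-1)) covF.
have xE c : (c <= n)%N -> x c = (r ^+ c)%:C *: x 0%N.
  elim: c => [|c IH] cn; first by rewrite expr0 scale1r.
  rewrite xS // (Hxg c cn : g c = _ *: _) betaE IH 1?ltnW // !scalerA -scalerBl.
  by congr (_ *: _); rewrite exprS !(rmorphM, rmorphD, rmorphN) /= rmorph1; ring.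
have F0 : F 0 = x n.-1.
  have := Fx n.-1; rewrite prednK // -[n%:R]add0r l2apN => FN.
  by apply: oppr_inj; rewrite FN ?leqnn //.
have x0E : x 0%N = (1 + r ^+ n)^-1%:C.
  have : ((1 + r ^+ n)%:C : R[i]) * x 0%N = 1.
    by rewrite -[RHS]x1 (xE n) // rmorphD rmorph1 mulrDl mul1r.
  move=> xr; have rC : (1 + r ^+ n)%:C != 0 :> R[i] by rewrite eq_complex /=
    negb_and Z0.
  by apply: (mulfI rC); rewrite xr -rmorphM mulfV.
have -> : cdot (F 0) ((1 : R[i]) : V) = (r ^+ n.-1 / (1 + r ^+ n))%:C.
  rewrite F0 xE ?leq_pred // x0E /cdot conjC1 mulr1.
  by rewrite -[LHS]/((r ^+ n.-1)%:C * (1 + r ^+ n)^-1%:C : R[i]) -rmorphM.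
rewrite normc_def /= expr0n addr0 sqrtr_sqr lecR sqrtr1 big1 // mulr1 muln1.
by apply: le_trans; exact: ler_norm.
Qed.

End LowerBound.

Lemma bernoulli_le (R : realDomainType) (e : R) k : 0 <= e -> 1 + k%:R * e <=
  (1 + e) ^+ k.
Proof.
move=> e0; elim: k => [|k IH]; first by rewrite mul0r addr0 expr0.
have : (1 + k%:R * e) * (1 + e) <= (1 + e) ^+ k.+1.
  by rewrite exprSr ler_wpM2r // addr_ge0.
apply: le_trans; rewrite -subr_ge0 -(natr1 k).
rewrite (_ : _ - _ = k%:R * e ^+ 2); last by ring.
by rewrite mulr_ge0 // exprn_ge0.
Qed.

Lemma complex_line_orthonormal_basis (R : realType) :
  orthonormal_basis (@cdot R) (fun _ : unit => ((1 : R[i]) : complex_line R)).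
Proof.
split=> [[] []|]; first by rewrite -[LHS]/((1 : R[i]) * Num.conj (1 : R[i]))
  conjC1 mulr1.
apply/seteqP; split=> // x _; apply: subset_closure.
exists [:: tt], (fun=> x); rewrite big_seq1.
by rewrite -[RHS]/((x : R[i]) * 1) mulr1.
Qed.

Lemma scalar_self_adjoint (R : realType) (c : R) :
  self_adjoint (@cdot R) (@scalar_op R (complex_line R) c).
Proof.
split; first exact: scalar_op_linear.
  apply/seteqP; split=> // x _; apply: subset_closure.
  by exists (c%:C *: x).
apply/seteqP; split=> [[x y] yE u v uv|[x y] adj].
  have -> : y = c%:C *: x := yE; have -> : v = c%:C *: u := uv.
  by rewrite /braket /= linearZl_LR linearZr_LR /= conj_realc.
have := adj ((1 : R[i]) : complex_line R) (c%:C *: ((1 : R[i]) : complex_line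
  R)) erefl.
rewrite /braket /= linearZl_LR /= /cdot !mul1r => xy.
rewrite /scalar_op /= -[y]conjCK -xy rmorphM /= [X in _ * X]conjCK.
by rewrite conj_realc.
Qed.

Lemma scalar_determinant_bound_ge1 (R : realType) (gamma : R) :
  determinant_bound (@cdot R) (fun _ : unit => ((1 : R[i]) : complex_line R))
    (@scalar_op R (complex_line R) (-1)) (cst 1) gamma -> 1 <= gamma.
Proof.
move=> bound; have [_ _ gamma0 _] := bound.
rewrite leNgt; apply/negP => gamma1.
have g2 : gamma ^+ 2 < 1 by rewrite expr_lt1 // ltW.
(* With [q = (1 + e)^(n-1)] and [e q >= 1], the quotient [q / (1 + (1 + e) q)] is at least
   [1 / (1 + 2 e)], which exceeds [1 - 4 e = gamma^2]. *)
pose e := (1 - gamma ^+ 2) / 4.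
have e0 : 0 < e by rewrite divr_gt0 // subr_gt0.
(* From [k e^2 > 1] and [n - 1 >= k], Bernoulli's inequality gives [e q >= 1]. *)
have [k ke] : exists k : nat, e ^- 2 < k%:R.
  exists (Num.bound (e ^- 2)); apply: archi_boundP.
  by rewrite invr_ge0 exprn_ge0 // ltW.
pose n := (k.+1).*2.
have n1 : (1 < n)%N by rewrite /n; lia.
have nev : ~~ odd n by rewrite odd_double.
have := scalar_determinant_bound n1 nev e0 bound.
set q := (1 + e) ^+ n.-1.
have -> : (1 + e) ^+ n = (1 + e) * q by rewrite /q -exprS prednK // ltnW.
have qe : 1 <= e * q.
  apply: (@le_trans _ _ (e * (1 + n.-1%:R * e))); last first.
    by rewrite ler_wpM2l ?(ltW e0) //; apply: bernoulli_le; exact: ltW.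
  have : 1 < k%:R * e ^+ 2 by rewrite -ltr_pdivrMr ?exprn_gt0 // mul1r.
  have : k%:R <= n.-1%:R :> R by rewrite ler_nat /n; lia.
  move: (k%:R) (n.-1%:R) => a b ab ae; nra.
have q0 : 0 < q by rewrite exprn_gt0 // addr_gt0.
rewrite ler_pdivrMr; last by rewrite addr_gt0 // mulr_gt0 // addr_gt0.
apply/negP; rewrite -ltNge.
have : gamma ^+ 2 = 1 - 4 * e by rewrite /e; field.
have : 0 < gamma ^+ 2 by rewrite exprn_gt0.
move: (gamma ^+ 2) => g; nra.
Qed.

Theorem corollary2p4 (R : realType) :
  ereal_sup [set v : \bar R |
    exists (V : completeNormedModType R[i]) (dot : {dot V for Num.conj})
           (I : countType) (phi : I -> V) (H : set (V * V)),
      [/\ hilbert_norm dot, orthonormal_basis dot phi, self_adjoint dot H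
        & v = ereal_inf [set gamma%:E | gamma in
                determinant_bound dot phi H (cst 1)]]] = 1%E.
Proof.
apply/eqP; rewrite eq_le; apply/andP; split.
  apply: ge_ereal_sup => _ [V [dot [I [phi [H [_ bphi saH ->]]]]]].
  by apply: ereal_inf_lbound; exists 1 => //; exact: determinant_bound1.
apply: le_trans (ereal_sup_ubound _); last first.
  exists (complex_line R), (@cdot R), unit, (fun=> ((1 : R[i]) : complex_line R)).
  exists (@scalar_op R (complex_line R) (-1)); split=> //.
  - by move=> x; rewrite normCK.
  - exact: complex_line_orthonormal_basis.
  - exact: scalar_self_adjoint.
apply: le_ereal_inf_tmp => _ [gamma bound <-].
by rewrite lee_fin; exact: scalar_determinant_bound_ge1 bound.
Qed.
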